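(* Let $S$ be a finite pseudo-nilpotent semigroup with principal series $S=S_1\supset S_2\supset\cdots\supset S_m\supset S_{m+1}=\emptyset$. Then: (1) The union $K$ of all isolated subsets $S_i\setminus S_{i+1}$ is the largest nilpotent ideal of $S$, and it is the set of all isolated vertices of $\mathcal{N}_S$ (possibly $K=\emptyset$). (2) If $S_{i_1}\setminus S_{i_1+1}\subseteq S^{(i_2)}$ and $S_{i_2}\setminus S_{i_2+1}\subseteq S^{(i_3)}$, then $S_{i_1}\setminus S_{i_1+1}\subseteq S^{(i_3)}$. If moreover $S_{i_2}\setminus S_{i_2+1}=\mathcal{M}(G_2,I_2,\Lambda_2;P_2)$ and $S_{i_3}\setminus S_{i_3+1}=\mathcal{M}(G_3,I_3,\Lambda_3;P_3)$ are not nilpotent and $\Phi_{i_2}$, $\Phi_{i_3}$ are the pseudo-nilpotent homomorphisms, then $\Phi_{i_3}(a)=\Phi_{i_3}((g;\Phi_{i_2}(a)))$ for every $a\in S_{i_1}\setminus S_{i_1+1}$ and every $g\in G_2$ (here $(g;\Phi_{i_2}(a))$ denotes $(g;e,f)\in S_{i_2}\setminus S_{i_2+1}$ where $(e,f)=\Phi_{i_2}(a)$). (3) If $S_i\setminus S_{i+1}$ is neither an isolated subset nor a root, then there exists a root $S_j\setminus S_{j+1}$ with $i<j$ and $S_i\setminus S_{i+1}\subseteq S^{(j)}$. (4) $S\setminus K=\bigcup S^{(i)}$, where the union runs over all $i$ such that $S_i\setminus S_{i+1}$ is a root. (5) Every stem $S^{(i)}$ is a subsemigroup of $S$. (6) $(S_i\setminus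 S_{i+1})(S_j\setminus S_{j+1})\subseteq K$ if and only if there is no stem containing both $S_i\setminus S_{i+1}$ and $S_j\setminus S_{j+1}$.
   Context: For a semigroup $S$, $S^1$ denotes $S$ with an identity adjoined (if $S$ has none). For $x,y\in S$, $z_1,z_2,\ldots\in S^1$ define $\lambda_0=x$, $\rho_0=y$, $\lambda_{n+1}=\lambda_n z_{n+1}\rho_n$, $\rho_{n+1}=\rho_n z_{n+1}\lambda_n$; write $\lambda_n(x,y,z_1,\ldots,z_n)$, $\rho_n(x,y,z_1,\ldots,z_n)$. $S$ is nilpotent (Mal'cev) if for some $n\ge1$, $\lambda_n(a,b,c_1,\ldots,c_n)=\rho_n(a,b,c_1,\ldots,c_n)$ for all $a,b\in S$, $c_i\in S^1$. $\langle X\rangle$ is the subsemigroup generated by $X$. The upper non-nilpotent graph $\mathcal{N}_S$ has vertex set $S$ and an edge between $x,y$ iff $\langle x,y\rangle$ is not nilpotent. The empty set counts as an ideal; $S/I$ is the Rees factor, $S/\emptyset=S$. $S$ is pseudo-nilpotent if: whenever $x,y\in S$, $w_1,\ldots,w_m\in S^1$, $T$ is the subsemigroup generated by $x,y$ and the $w_i$ lying in $S$, $I$ is a (possibly empty) ideal of $T$, and $t<m$ are non-negative integers with (writing $\lambda_k=\lambda_k(x,y,w_1,\ldots,w_k)$, $\rho_k$ likewise) $\lambda_t\neq\rho_t$, $(\lambda_t,\rho_t)=(\lambda_m,\rho_m)$, $\lambda_m,\rho_m\notin I$, then for all $0\le i\le m$ there is an edge in $\mathcal{N}_{T/I}$ between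 (the images of) $\lambda_i$ and $\rho_i$. A principal series means each $S_i$ is an ideal of $S$ and no ideal lies strictly between $S_{i+1}$ and $S_i$; principal factors are $S_i/S_{i+1}$. For $1\le j\le m$ put $F^{(j)}=\{s\in S\setminus S_j: st\notin S_{j+1}\text{ or }ts\notin S_{j+1}\text{ for some }t\in S_j\setminus S_{j+1}\}$ (the paper's $F_{S_j/S_{j+1}}(S/S_{j+1})$) and $S^{(j)}=F^{(j)}\cup(S_j\setminus S_{j+1})$. $S_i\setminus S_{i+1}$ is a root if $S_i/S_{i+1}$ is not nilpotent and $\langle a,b\rangle$ is nilpotent for all $a\in S_i\setminus S_{i+1}$, $b\in S_{i+1}$; then $S^{(i)}$ is called a stem. $S_i\setminus S_{i+1}$ is an isolated subset if it is not a root and, for every $j$ with $S_i\setminus S_{i+1}\subseteq F^{(j)}$, $S_j/S_{j+1}$ is nilpotent. Rees matrix notation: $\mathcal{M}(G,I,\Lambda;P)$ ($P=(p_{\lambda,i})$ a $\Lambda\times I$ matrix over $G$) consists of triples $(g;i,\lambda)$ with $(g;i,\lambda)(h;j,\mu)=(gp_{\lambda,j}h;i,\mu)$; $G_{i,\ast}=\{(g;i,\lambda):g\in G,\lambda\in\Lambda\}$, $G_{\ast,\lambda}=\{(g;i,\lambda):g\in G,i\in I\}$. If $S_i/S_{i+1}$ is not nilpotent, then $S_i\setminus S_{i+1}$ is a semigroup $\mathcal{M}(G,I,\Lambda;P)$ with all entries of $P$ in $G$, and the pseudo-nilpotent homomorphism $\Phi_i:S\to(I\times\Lambda)^0$ (the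 rectangular band $(i,\lambda)(j,\mu)=(i,\mu)$ with a zero $\theta$ adjoined) is given by $\Phi_i(a)=(e,f)$ for $a\in S^{(i)}$, where $e\in I$, $f\in\Lambda$ are the (unique) indices with $a(S_i\setminus S_{i+1})\subseteq G_{e,\ast}$ and $(S_i\setminus S_{i+1})a\subseteq G_{\ast,f}$, and $\Phi_i(a)=\theta$ for $a\notin S^{(i)}$. *)

(* Defs.v *)
(* A finite semigroup is a finType T with an associative
   binary operation mul. *)
From mathcomp Require Import all_boot all_fingroup.
Set Implicit Arguments. Unset Strict Implicit. Unset Printing Implicit Defensive.

Section SemigroupDefs.
Variables (T : finType) (mul : T -> T -> T).

(* S^1 is modelled by option T, None being the adjoined identity. *)
Definition mul3 (x : T) (z : option T) (y : T) : T :=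
  match z with None => mul x y | Some c => mul (mul x c) y end.

Definition lr (x y : T) (zs : seq (option T)) : T * T :=
  foldl (fun p z => (mul3 p.1 z p.2, mul3 p.2 z p.1)) (x, y) zs.

Definition in1 (A : {set T}) (c : option T) : bool :=
  if c is Some c' then c' \in A else true.

(* Mal'cev nilpotency of the Rees quotient A/I, where A is a subsemigroup and
   I a (possibly empty) ideal of A; equality in A/I means equal, or both in I.
   With I = set0 this is nilpotency of A itself. *)
Definition nilpotent_mod (A I : {set T}) : Prop :=
  exists n : nat, 0 < n /\
    forall a b (cs : seq (option T)), a \in A -> b \in A ->
      size cs = n -> all (in1 A) cs ->
      (lr a b cs).1 = (lr a b cs).2 \/
      ((lr a b cs).1 \in I /\ (lr a b cs).2 \in I).

Definition sg_nilpotent (A : {set T}) : Prop := nilpotent_mod A set0.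

Definition sg_closed (A : {set T}) : bool :=
  [forall x in A, forall y in A, mul x y \in A].

Definition sg_gen (X : {set T}) : {set T} :=
  [set x | [forall B : {set T}, (X \subset B) && sg_closed B ==> (x \in B)]].

Definition is_ideal_in (A I : {set T}) : Prop :=
  I \subset A /\ forall a x, a \in A -> x \in I -> mul a x \in I /\ mul x a \in I.

(* edge between (the images of) x and y in the upper non-nilpotent graph of
   the Rees quotient A/I (I = set0 gives N_A). *)
Definition edge_mod (A I : {set T}) (x y : T) : Prop :=
  ~ nilpotent_mod (sg_gen [set x; y]) (sg_gen [set x; y] :&: I).

Definition sg_edge (x y : T) : Prop := edge_mod setT set0 x y.

Definition wset (ws : seq (option T)) : {set T} := [set c | Some c \in ws].

Definition pseudo_nilpotent : Prop :=
  forall (x y : T) (ws : seq (option T)) (I : {set T}) (t : nat),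
    let Tg := sg_gen (x |: (y |: wset ws)) in
    is_ideal_in Tg I -> t < size ws ->
    (lr x y (take t ws)).1 <> (lr x y (take t ws)).2 ->
    lr x y (take t ws) = lr x y ws ->
    (lr x y ws).1 \notin I -> (lr x y ws).2 \notin I ->
    forall i, i <= size ws ->
      edge_mod Tg I (lr x y (take i ws)).1 (lr x y (take i ws)).2.

Definition principal_series (m : nat) (Ss : nat -> {set T}) : Prop :=
  Ss 1 = setT /\ Ss m.+1 = set0 /\
  forall i, 1 <= i <= m ->
    is_ideal_in setT (Ss i) /\ Ss i.+1 \proper Ss i /\
    forall J, is_ideal_in setT J -> Ss i.+1 \subset J -> J \subset Ss i ->
      J = Ss i.+1 \/ J = Ss i.

Definition Dif (Ss : nat -> {set T}) (i : nat) : {set T} := Ss i :\: Ss i.+1.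

Definition Fset (Ss : nat -> {set T}) (j : nat) : {set T} :=
  [set s | (s \notin Ss j) &&
     [exists t in Dif Ss j, (mul s t \notin Ss j.+1) || (mul t s \notin Ss j.+1)]].

Definition Sup (Ss : nat -> {set T}) (j : nat) : {set T} :=
  Fset Ss j :|: Dif Ss j.

Definition is_root (Ss : nat -> {set T}) (i : nat) : Prop :=
  ~ nilpotent_mod (Ss i) (Ss i.+1) /\
  forall a b, a \in Dif Ss i -> b \in Ss i.+1 -> sg_nilpotent (sg_gen [set a; b]).

Definition isolated (m : nat) (Ss : nat -> {set T}) (i : nat) : Prop :=
  ~ is_root Ss i /\
  forall j, 1 <= j <= m -> Dif Ss i \subset Fset Ss j ->
    nilpotent_mod (Ss j) (Ss j.+1).

(* D is (via phi) isomorphic to the Rees matrix semigroup M(gT, I, L; P),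
   where (g; i, l) is the triple (g, i, l) and
   (g; i, l)(h; j, n) = (g p_{l,j} h; i, n). *)
Definition rees_mul (gT : finGroupType) (I L : finType) (P : L -> I -> gT)
  (u v : gT * I * L) : gT * I * L :=
  (((u.1.1 * P u.2 v.1.2 * v.1.1)%g, u.1.2), v.2).

Definition rees_iso (D : {set T}) (gT : finGroupType) (I L : finType)
  (P : L -> I -> gT) (phi : T -> gT * I * L) : Prop :=
  {in D &, injective phi} /\
  (forall u, exists2 x, x \in D & phi x = u) /\
  (forall x y, x \in D -> y \in D ->
     mul x y \in D /\ phi (mul x y) = rees_mul P (phi x) (phi y)).

(* The pseudo-nilpotent homomorphism Phi_i : S -> (I x L)^0, None = theta. *)
Definition Phi (Ss : nat -> {set T}) (i : nat) (gT : finGroupType)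
  (I L : finType) (phi : T -> gT * I * L) (a : T) : option (I * L) :=
  if a \in Sup Ss i then
    [pick p : I * L |
       [forall t in Dif Ss i, (mul a t \in Dif Ss i) && ((phi (mul a t)).1.2 == p.1)]
    && [forall t in Dif Ss i, (mul t a \in Dif Ss i) && ((phi (mul t a)).2 == p.2)]]
  else None.

End SemigroupDefs.

(* Main.v *)
Require Import Defs.
From mathcomp Require Import all_boot all_fingroup zify.
From Stdlib Require Import Classical.
Set Implicit Arguments. Unset Strict Implicit. Unset Printing Implicit Defensive.

(* By finiteness, failure of nilpotency modulo an ideal yields a pair on which
   the recursion (a, b) -> (a z b, b z a) can be continued forever without
   merging or entering the ideal; pseudo-nilpotency says that such a wandering
   pair generates a non-nilpotent subsemigroup.  In particular it does not
   commute, and its products do not vanish.  Wandering pairs inside one R-class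
   can be translated by left multiplication into any other R-class of the same
   J-class, which forces a J-class with non-nilpotent principal factor to be a
   subsemigroup with more than one H-class.  An element a acting on such a
   J-class J commutes with some idempotent l of J; were a z not R-related to l
   for some z in J, the commuting pair (a, l) would wander, so a J lies in one
   R-class.  Finally, if <a, b> is not nilpotent, a wandering pair of <a, b>
   settles in one J-class, on which both a and b act.  Hence K is the complement
   of the union of the S^(j) over the non-nilpotent factors, and each of these
   lies in one belonging to a root. *)

(** * Consequences of finiteness *)

Lemma pigeonhole (T : finType) (f : nat -> T) :
  exists i j, i < j <= #|T| /\ f i = f j.
Proof.
have /injectivePn [i [j neq_ij eq_f]] :
    ~~ injectiveb (fun i : 'I_#|T|.+1 => f i).
  apply/negP => /injectiveP /leq_card; by rewrite card_ord ltnn.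
have [lt_ij|lt_ji|/val_inj eq_ij] := ltngtP i j.
- by exists i, j; rewrite lt_ij -ltnS ltn_ord.
- by exists j, i; rewrite lt_ji -ltnS ltn_ord.
by rewrite eq_ij eqxx in neq_ij.
Qed.

Lemma decreasing_stabilises (T : finType) (X : nat -> {set T}) :
  (forall n, X n.+1 \subset X n) -> exists n, X n.+1 = X n.
Proof.
move=> decr; apply: NNPP => nostab.
have le_card k : #|X k| + k <= #|X 0|.
  elim: k => [|k IHk]; first by rewrite addn0.
  apply: leq_trans IHk; rewrite addnS -addSn leq_add2r.
  apply: proper_card; rewrite properEneq decr andbT.
  by apply/eqP => eqX; apply: nostab; exists k.
by have := le_card #|X 0|.+1; rewrite addnS ltnNge leq_addl.
Qed.

Definition inS := (in_setU, in_setI, in_setD, in_set1, in_setT).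

(** * Generated subsemigroups, ideals and commutation *)

Section Semigroup.
Variables (T : finType) (mul : T -> T -> T).
Hypothesis mulA : associative mul.
Local Infix "**" := mul (at level 40, left associativity).
Local Notation gen := (sg_gen mul).
Local Notation mul3 := (mul3 mul).
Implicit Types (x y a b c : T) (z : option T) (A B I C X : {set T}).

Lemma closedM A x y : sg_closed mul A -> x \in A -> y \in A -> x ** y \in A.
Proof. by move=> /forall_inP cA xA yA; have /forall_inP -> := cA _ xA. Qed.

Lemma closedM3 A x y z :
  sg_closed mul A -> x \in A -> y \in A -> in1 A z -> mul3 x z y \in A.
Proof. by move=> cA xA yA; case: z => [c|] ?; rewrite /= ?closedM. Qed.

Lemma idealM3 A I x y z :
  sg_closed mul A -> is_ideal_in mul A I -> x \in A -> y \in A -> in1 A z ->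
  (x \in I) || (y \in I) -> mul3 x z y \in I.
Proof.
move=> cA [_ idI] xA yA zA /orP[xI|yI]; case: z zA => [c|] zA /=.
- by apply: (idI _ _ yA _).2; apply: (idI _ _ zA xI).2.
- exact: (idI _ _ yA xI).2.
- by apply: (idI _ _ _ yI).1; apply: closedM.
- exact: (idI _ _ xA yI).1.
Qed.

Lemma sub_gen X : X \subset gen X.
Proof.
apply/subsetP => x xX; rewrite inE; apply/forallP => B.
by apply/implyP => /andP[/subsetP sXB _]; apply: sXB.
Qed.

Lemma gen_min X A : X \subset A -> sg_closed mul A -> gen X \subset A.
Proof.
move=> sXA cA; apply/subsetP => x; rewrite inE => /forallP/(_ A).
by rewrite sXA cA.
Qed.

Lemma gen_closed X : sg_closed mul (gen X).
Proof.
apply/forall_inP => x xX; apply/forall_inP => y yX; rewrite inE.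
apply/forallP => B; apply/implyP => /andP[sXB cB].
by apply: closedM => //; apply: (subsetP (gen_min sXB cB)).
Qed.

Lemma gen_commute X :
  {in X &, commutative mul} -> {in gen X &, commutative mul}.
Proof.
move=> cX.
(* The centralizer of an element is a subsemigroup; this is used twice, once for each argument. *)
have cent1 y (Y : {set T}) : {in Y, forall x, x ** y = y ** x} ->
    {in gen Y, forall x, x ** y = y ** x}.
  move=> cYy x; suff /subsetP sub : gen Y \subset [set x | x ** y == y ** x].
    by move=> /sub; rewrite inE => /eqP.
  apply: gen_min; first by apply/subsetP => u /cYy/eqP; rewrite inE.
  apply/forall_inP => u; rewrite inE => /eqP cu.
  apply/forall_inP => v; rewrite !inE => /eqP cv.
  by rewrite -mulA cv !mulA cu.
have cXg : {in X, forall y, {in gen X, forall x, x ** y = y ** x}}.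
  by move=> y yX; apply: cent1 => x xX; apply: cX.
by move=> x y xg yg; symmetry; apply: cent1 yg => u uX; symmetry; apply: cXg.
Qed.

Lemma commute3 A x y z : {in A &, commutative mul} ->
  sg_closed mul A -> x \in A -> y \in A -> in1 A z -> mul3 x z y = mul3 y z x.
Proof.
move=> cmA cA xA yA; case: z => [c|] zA /=; last exact: cmA.
by rewrite -mulA cmA ?closedM // (cmA c) // -!mulA (cmA c).
Qed.

(* [C] is an ideal of <x, y> containing [x], so outside [C] only the
   (commuting) powers of [y] remain. *)
Lemma noncommuting3_in_ideal C x y a b z :
  let A := gen [set x; y] in
  {in C & A, forall c d, (c ** d \in C) && (d ** c \in C)} -> x \in C ->
  a \in A -> b \in A -> in1 A z -> mul3 a z b != mul3 b z a ->
  (mul3 a z b \in C) && (mul3 b z a \in C).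
Proof.
move=> A absC xC aA bA zA neq.
have clA : sg_closed mul A := gen_closed _.
have sgA : gen [set y] \subset A.
  apply: gen_min => //; rewrite sub1set.
  by apply: (subsetP (sub_gen _)); rewrite !inS eqxx orbT.
have split u : u \in A -> (u \in C) || (u \in gen [set y]).
  suff /subsetP sub : A \subset (C :&: A) :|: gen [set y].
    by move=> /sub; rewrite !inS => /orP[/andP[-> _]|->]; rewrite ?orbT.
  apply: gen_min.
    apply/subsetP => v; rewrite !inS => /orP[]/eqP->.
      by rewrite xC (subsetP (sub_gen [set x; y]) x) ?set21.
    by rewrite orbC; rewrite (subsetP (sub_gen [set y])) ?set11.
  apply/forall_inP => v vU; apply/forall_inP => w wU.
  have vA : v \in A by move: vU; rewrite in_setU in_setI => /orP[/andP[]|/(subsetP sgA)].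
  have wA : w \in A by move: wU; rewrite in_setU in_setI => /orP[/andP[]|/(subsetP sgA)].
  have vwA := closedM clA vA wA.
  move: vU wU; rewrite !in_setU !in_setI vA wA vwA !andbT.
  case/orP=> [vC _|vg]; first by case/andP: (absC _ _ vC wA) => ->.
  case/orP=> [wC|wg]; first by case/andP: (absC _ _ wC vA) => _ ->.
  by rewrite (closedM (gen_closed _)) ?orbT.
have absl c d : c \in C -> d \in A -> c ** d \in C by move=> cC /(absC _ _ cC)/andP[].
have absr c d : c \in C -> d \in A -> d ** c \in C by move=> cC /(absC _ _ cC)/andP[].
(* One factor in [C] puts both products in [C]; if there is none, all three factors are powers of
   [y] and the products coincide. *)
have [aC|ag] := orP (split _ aA).
  case: z zA {neq} => [c|] /= zA; last by rewrite absl ?absr.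
  by apply/andP; split; [apply/absl/bA/absl | apply/absr/closedM].
have [bC|bg] := orP (split _ bA).
  case: z zA {neq} => [c|] /= zA; last by rewrite absr ?absl.
  by apply/andP; split; [apply/absr/closedM | apply/absl/aA/absl].
case: z zA neq => [c|] /= zA neq; last first.
  by rewrite (gen_commute _ ag bg) ?eqxx // in neq => u v /set1P-> /set1P->.
have [cC|cg] := orP (split _ zA); first by apply/andP; split; apply/absl => //; apply/absr.
case/eqP: neq; apply: (@commute3 (gen [set y]) a b (Some c)); rewrite ?gen_closed //.
by apply: gen_commute => u v /set1P-> /set1P->.
Qed.

Lemma nilpotent_mod_sub A B I : A \subset B ->
  nilpotent_mod mul B I -> sg_closed mul A ->
  nilpotent_mod mul A (A :&: I).
Proof.
move=> /subsetP sAB [n [n0 nilB]] cA; exists n; split=> // a b cs aA bA szcs csA.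
have csB : all (in1 B) cs.
  by apply: sub_all csA => -[c|] //=; apply: sAB.
case: (nilB a b cs (sAB _ aA) (sAB _ bA) szcs csB) => [|[l r]]; first by left.
right; suff [lA rA]: (lr mul a b cs).1 \in A /\ (lr mul a b cs).2 \in A.
  by rewrite !inS l r lA rA.
elim: cs a b aA bA csA {szcs csB l r} => [|z cs IH] a b aA bA //= /andP[zA csA].
by apply: IH => //; apply: closedM3.
Qed.

(** * Pairs on which the lambda/rho recursion can run forever *)

(** An endless run is encoded by an invariant relation [P], so that a wandering pair is produced by
    exhibiting a relation that suitable multipliers preserve. *)
Definition wander A I (P : T -> T -> Prop) :=
  forall a b, P a b ->
    [/\ a != b, a \in A :\: I, b \in A :\: I
      & exists2 z, in1 A z & P (mul3 a z b) (mul3 b z a)].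

Definition wan A I x y := exists2 P, P x y & wander A I P.

Lemma wanP A I x y : wan A I x y ->
  [/\ x != y, x \in A :\: I, y \in A :\: I
    & exists2 z, in1 A z & wan A I (mul3 x z y) (mul3 y z x)].
Proof.
case=> P Pxy wP; case: (wP _ _ Pxy) => neq xA yA [z zA Pz]; split=> //.
by exists z => //; exists P.
Qed.

Lemma wan_sym A I x y : wan A I x y -> wan A I y x.
Proof.
case=> P Pxy wP; exists (fun a b => P b a) => // a b /wP[neq bA aA [z zA Pz]].
by split=> //; [rewrite eq_sym | exists z].
Qed.

Lemma wan_sub A B I I' x y :
  A \subset B -> I' \subset I -> wan A I x y -> wan B I' x y.
Proof.
move=> /subsetP sAB /subsetP sI [P Pxy wP]; exists P => // a b /wP[neq].
rewrite !in_setD => /andP[aI /sAB->] /andP[bI /sAB->] [z zA Pz].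
rewrite (contra (sI a)) // (contra (sI b)) //; split=> //.
by exists z => //; case: z zA {Pz} => //= c; apply: sAB.
Qed.

Fixpoint survives A I n (p : T * T) : bool :=
  if n is n'.+1 then
    [exists z, in1 A z && survives A I n' (mul3 p.1 z p.2, mul3 p.2 z p.1)]
  else (p.1 != p.2) && ~~ ((p.1 \in I) && (p.2 \in I)).

Lemma survives_lr A I a b cs : all (in1 A) cs ->
  survives A I 0 (lr mul a b cs) -> survives A I (size cs) (a, b).
Proof.
elim: cs a b => [|z cs IH] a b // /andP[zA csA] sv; rewrite /size -/(size cs).
by apply/existsP; exists z; rewrite zA; apply: IH.
Qed.

(** The sets [X n] of pairs that can be kept distinct modulo [I] for [n] steps decrease, hence
    stabilise. A nonempty stable set is itself a wandering relation; an empty one bounds the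
    recursion and makes [A] nilpotent modulo [I]. *)
Lemma non_nilpotent_wan A I : sg_closed mul A -> is_ideal_in mul A I ->
  ~ nilpotent_mod mul A I -> exists x y, wan A I x y.
Proof.
move=> cA idI nnil.
have decr1 n p : p.1 \in A -> p.2 \in A ->
    survives A I n.+1 p -> survives A I n p.
  elim: n p => [|n IH] [a b] aA bA /existsP[z /andP[zA]] /=.
    move=> /andP[neq nI]; apply/andP; split.
      by apply: contraNneq neq => ->.
    apply: contra nI => /andP[aI bI].
    by apply/andP; split; apply: (idealM3 cA) => //; rewrite ?aI ?bI.
  move=> sv; apply/existsP; exists z; rewrite zA; apply: IH => //=; exact: closedM3.
pose X n := [set p | [&& p.1 \in A, p.2 \in A & survives A I n p]].
have decr n : X n.+1 \subset X n.
  apply/subsetP => p; rewrite !inE => /and3P[p1 p2 sv].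
  by rewrite p1 p2 /=; apply: decr1.
have decr0 n p : p \in X n -> survives A I 0 p.
  by elim: n => [|n IH]; [rewrite inE => /and3P[] | move/(subsetP (decr n))].
have [N stN] := decreasing_stabilises decr.
have [X0|/set0Pn[[x y] xyX]] := eqVneq (X N) set0; last first.
  exists x, y, (fun a b => (a, b) \in X N) => // a b abX.
  have := decr0 _ _ abX; move: abX; rewrite -{1}stN inE => /and3P[/= aA bA].
  case/existsP=> z /andP[zA sv] /andP[neq _].
  have nX : (mul3 a z b, mul3 b z a) \in X N by rewrite inE /= !closedM3.
  (* A single entry of the pair in [I] would put both entries of the next pair in [I]. *)
  have /andP[_ nI] := decr0 _ _ nX.
  split=> //; last by exists z.
    rewrite in_setD aA andbT; apply: contra nI => aI.
    by apply/andP; split; apply: (idealM3 cA); rewrite ?aI ?orbT.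
  rewrite in_setD bA andbT; apply: contra nI => aI.
  by apply/andP; split; apply: (idealM3 cA); rewrite ?aI ?orbT.
(* The successor [N.+1] supplies the positive length that nilpotency requires. *)
case: nnil; exists N.+1; split=> // a b cs aA bA szcs csA.
apply: NNPP => ncon; have : (a, b) \in X N.+1.
  rewrite inE aA bA /= -/(survives A I N.+1 (a, b)) -szcs; apply: survives_lr => //=.
  apply/andP; split; first by apply/eqP => e; apply: ncon; left.
  by apply/negP => /andP[l r]; apply: ncon; right.
by rewrite stN X0 inE.
Qed.

Lemma wan_path I x y n : wan setT I x y ->
  exists2 cs, size cs = n & forall i, i <= n ->
    wan setT I (lr mul x y (take i cs)).1 (lr mul x y (take i cs)).2.
Proof.
elim: n x y => [|n IH] x y w; first by exists [::].
case: (wanP w) => _ _ _ [z _ /IH[cs szcs wcs]].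
by exists (z :: cs) => [|[|i]] //=; [rewrite szcs | apply: wcs].
Qed.

(** A wandering path longer than the number of pairs repeats a pair, which is the cycle in the
    definition of pseudo-nilpotency, taken with the ideal [G :&: I]. The edge it gives at index [0]
    concerns [x] and [y] themselves. *)
Lemma pseudo_nilpotent_wan I x y : pseudo_nilpotent mul ->
  is_ideal_in mul setT I -> wan setT I x y ->
  ~ nilpotent_mod mul (gen [set x; y]) (gen [set x; y] :&: I).
Proof.
move=> pn [_ idI] w.
have [cs szcs wcs] := wan_path #|[the finType of (T * T)%type]| w.
have [i [j [/andP[lt_ij le_j] eq_ij]]] := pigeonhole (fun i => lr mul x y (take i cs)).
set ws := take j cs.
have szws : size ws = j by rewrite size_takel // szcs.
have tws k : k <= j -> take k ws = take k cs by move=> le_kj; rewrite take_takel.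
set G := gen (x |: (y |: wset ws)).
have idG : is_ideal_in mul G (G :&: I).
  split; first exact: subsetIl.
  move=> a c aG; rewrite !in_setI => /andP[cG cI].
  have [-> ->] := idI a c (in_setT _) cI.
  by rewrite !andbT; split; apply: closedM (gen_closed _) _ _.
have [/eqP neq _ _ _] := wanP (wcs i (leq_trans (ltnW lt_ij) le_j)).
have [_ lj rj _] := wanP (wcs j le_j).
have nG u : u \in setT :\: I -> u \notin G :&: I.
  by rewrite in_setD in_setI => /andP[/negPf-> _]; rewrite andbF.
have lt_i : i < size ws by rewrite szws.
have eqi : take i ws = take i cs by apply: tws; apply: ltnW.
have := pn x y ws _ i idG lt_i.
rewrite eqi => /(_ neq eq_ij (nG _ lj) (nG _ rj) 0 (leq0n _)).
suff /setIidPl sG : gen [set x; y] \subset G by rewrite take0 /edge_mod setIA sG.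
apply: gen_min (gen_closed _); apply: subset_trans (sub_gen _).
by apply/subsetP => u; rewrite !inS => /orP[]->; rewrite ?orbT.
Qed.

(* Unlike [pseudo_nilpotent], visibly invariant under reversing [mul]. *)
Definition tame := forall I x y, is_ideal_in mul setT I -> wan setT I x y ->
  [/\ x ** y <> y ** x, ~ (x ** x \in I /\ x ** y \in I)
    & ~ (x ** x \in I /\ y ** x \in I)].

(** Since [A], generated by [x] and [y], is not nilpotent modulo [I], it contains a wandering pair,
    whose successor [(l, r)] is unequal and so excludes commutation. In the other two cases [x] lies
    in the one-sided annihilator [C] of [A] modulo [I], which absorbs [A] on both sides; then [l]
    and [r] lie in [C] and the next step falls into [I]. *)
Lemma pseudo_nilpotent_tame : pseudo_nilpotent mul -> tame.
Proof.
move=> pn I x y idI /(pseudo_nilpotent_wan pn idI).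
set A := gen _ => nnil; have cA : sg_closed mul A := gen_closed _.
have sA := subsetP (sub_gen [set x; y]).
have idAI : is_ideal_in mul A (A :&: I).
  split; first exact: subsetIl.
  move=> a c aG; rewrite !inS => /andP[cG cI].
  by have [-> ->] := idI.2 a c (in_setT _) cI; rewrite !andbT !closedM.
have [a [b w]] := non_nilpotent_wan cA idAI nnil.
have idl u v : u \in I -> v ** u \in I by move=> uI; apply: (idI.2 _ _ (in_setT v) uI).1.
have idr u v : u \in I -> u ** v \in I by move=> uI; apply: (idI.2 _ _ (in_setT v) uI).2.
case: (wanP w); rewrite !inS => _ /andP[_ aA] /andP[_ bA] [z zA /wanP].
set l := mul3 a z b; set r := mul3 b z a; rewrite !inS => -[lr /andP[_ lA] /andP[_ rA]].
case=> z' zA' /wanP[_]; rewrite !inS => /andP[l'I l'A] /andP[r'I r'A] _.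
have key C : {in C & A, forall c d, (c ** d \in C) && (d ** c \in C)} -> x \in C ->
    (l \in C) && (r \in C).
  by move=> absC xC; exact: (noncommuting3_in_ideal absC xC aA bA zA lr).
split.
- move=> cxy; case/eqP: lr; apply: (@commute3 A) => //; apply: gen_commute.
  by move=> u v; rewrite !inS => /orP[]/eqP-> /orP[]/eqP->.
- case=> xx xy; pose C := [set c | [forall d in A, c ** d \in I]].
  have CE c : (c \in C) = [forall d in A, c ** d \in I] by rewrite in_set.
  have /andP[lC rC] : (l \in C) && (r \in C).
    apply: key => [c d|]; rewrite !CE.
      move=> /forall_inP cC dA; apply/andP; split; apply/forall_inP => e eA.
        by rewrite -mulA cC // closedM.
      by rewrite -mulA idl ?cC.
    apply/forall_inP => d dA; suff /subsetP/(_ d dA) : A \subset [set d | x ** d \in I] by rewrite inE.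
    apply: gen_min; first by apply/subsetP => u; rewrite !inE => /orP[]/eqP->.
    by apply/forall_inP => u; rewrite inE => uI; apply/forall_inP => v _; rewrite inE mulA idr.
  move: lC; rewrite CE => /forall_inP lC; case/negP: l'I; rewrite l'A /=.
  by case: z' zA' {l'A r'A r'I} => [e|] /= eA; [apply: idr|]; apply: lC.
- case=> xx yx; pose C := [set c | [forall d in A, d ** c \in I]].
  have CE c : (c \in C) = [forall d in A, d ** c \in I] by rewrite in_set.
  have /andP[lC rC] : (l \in C) && (r \in C).
    apply: key => [c d|]; rewrite !CE.
      move=> /forall_inP cC dA; apply/andP; split; apply/forall_inP => e eA.
        by rewrite mulA idr ?cC.
      by rewrite mulA cC // closedM.
    apply/forall_inP => d dA; suff /subsetP/(_ d dA) : A \subset [set d | d ** x \in I] by rewrite inE.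
    apply: gen_min; first by apply/subsetP => u; rewrite !inE => /orP[]/eqP->.
    by apply/forall_inP => u uI; apply/forall_inP => v; rewrite !inE -mulA => ?; apply: idl.
  move: rC; rewrite CE => /forall_inP rC; case/negP: l'I; rewrite l'A /=.
  by case: z' zA' {l'A r'A r'I} => [e|] /= eA; apply: rC; rewrite ?closedM.
Qed.

End Semigroup.

(** * Green's relations on a finite J-class *)

Section Green.
Variables (T : finType) (mul : T -> T -> T).

Definition lm (p : option T) x := if p is Some c then mul c x else x.
Definition rm x (q : option T) := if q is Some c then mul x c else x.

Definition Rrel x y := (exists s, y = rm x s) /\ (exists t, x = rm y t).
Definition Lrel x y := (exists s, y = lm s x) /\ (exists t, x = lm t y).

(* [J] is a J-class lying immediately above the ideal [I]. *)
Record jclass (I J : {set T}) : Prop := JClass {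
  jclass_ideal : is_ideal_in mul setT I;
  jclass_idealU : is_ideal_in mul setT (I :|: J);
  jclass_disj : forall x, x \in J -> x \notin I;
  jclass_conn : forall a b, a \in J -> b \in J -> exists p q, b = lm p (rm a q) }.

Definition opm x y := mul y x.

(* [pw x n] is x^(n+1). *)
Definition pw x n := iter n (fun y => mul y x) x.

End Green.

(** * Left-right duality *)

Section Opposite.
Variables (T : finType) (mul : T -> T -> T).
Hypothesis mulA : associative mul.

Lemma opmA : associative (opm mul).
Proof. by move=> x y z; rewrite /opm mulA. Qed.

Lemma rm_lm p x q : rm mul (lm mul p x) q = lm mul p (rm mul x q).
Proof. by case: p q => [p|] [q|] //=; rewrite mulA. Qed.

Lemma ideal_op A I : is_ideal_in mul A I -> is_ideal_in (opm mul) A I.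
Proof. by case=> sIA idI; split=> // a x aA xI; case: (idI a x aA xI). Qed.

Lemma jclass_op I J : jclass mul I J -> jclass (opm mul) I J.
Proof.
case=> idI idIJ dis conn; split=> //; try exact: ideal_op.
move=> a b aJ bJ; have [p [q ->]] := conn a b aJ bJ.
by exists q, p; rewrite -rm_lm.
Qed.

Lemma mul3_op x z y : mul3 (opm mul) x z y = mul3 mul y z x.
Proof. by case: z => [c|] //=; rewrite /opm mulA. Qed.

(** Reversing the multiplication exchanges the two entries at each step, so the relation is
    symmetrised. *)
Lemma wan_op A I x y : wan (opm mul) A I x y -> wan mul A I x y.
Proof.
case=> P Pxy wP; exists (fun a b => P a b \/ P b a); first by left.
move=> a b [/wP|/wP] [neq aA bA [z zA Pz]]; split=> //; rewrite 1?eq_sym //.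
  by exists z => //; rewrite !mul3_op in Pz; right.
by exists z => //; rewrite !mul3_op in Pz; left.
Qed.

Lemma tame_op : tame mul -> tame (opm mul).
Proof.
move=> tm I x y idI /wan_op w.
have idI' : is_ideal_in mul setT I by case: idI => s id; split=> // a u aA /(id _ _ aA)[].
by case: (tm I x y idI' w) => neq n1 n2; split=> //; rewrite /opm => e; apply: neq.
Qed.

End Opposite.

(** * Powers, R-classes and stability *)

Section Basics.
Variables (T : finType) (mul : T -> T -> T).
Hypothesis mulA : associative mul.
Local Infix "**" := mul (at level 40, left associativity).
Local Notation mul3 := (mul3 mul).
Local Notation pw := (pw mul).

Lemma pw_add x m n : pw x (m + n) = iter m (fun y => y ** x) (pw x n).
Proof. exact: iterD. Qed.

Lemma pwD x m n : pw x m ** pw x n = pw x (m + n).+1.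
Proof. by elim: n => [|n IH]; rewrite ?addn0 // addnS /= mulA IH. Qed.

Lemma pw_comm x n : x ** pw x n = pw x n ** x.
Proof. by rewrite -[x]/(pw x 0) !pwD addn0. Qed.

(** The iterates satisfy [f^n (g^n x) = x]; applying [f^i] to a repetition [g^i x = g^j x] cancels
    [g^i] and leaves [g^(j-i) x = x]. *)
Lemma iter_recurrent (f g : T -> T) x :
  (forall y, f (g y) = g (f y)) -> f (g x) = x ->
  exists2 k, 0 < k & iter k g x = x.
Proof.
move=> comm fix_x; have [i [j [/andP[lt_ij _] eq_ij]]] := pigeonhole (fun i => iter i g x).
have cfi n y : f (iter n g y) = iter n g (f y).
  by elim: n => //= n IH; rewrite comm IH.
have fgk n : iter n f (iter n g x) = x.
  by elim: n => // n IH; rewrite !iterSr cfi fix_x.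
have cfi2 m n y : iter m f (iter n g y) = iter n g (iter m f y).
  by elim: m => //= m IH; rewrite IH cfi.
exists (j - i); first by rewrite subn_gt0.
by rewrite -[in LHS](fgk i) -cfi2 -iterD subnK ?(ltnW lt_ij) // -eq_ij fgk.
Qed.

Lemma idempotent_power x : exists n, pw x n ** pw x n = pw x n.
Proof.
have [i [j [/andP[lt_ij _] eq_ij]]] := pigeonhole (pw x).
have per n : i <= n -> pw x (n + (j - i)) = pw x n.
  move=> le_in; have -> : n + (j - i) = (n - i) + j by lia.
  by rewrite pw_add -eq_ij -pw_add subnK.
have perM k n : i <= n -> pw x (n + k * (j - i)) = pw x n.
  move=> le_in; elim: k => [|k IH]; first by rewrite mul0n addn0.
  by rewrite mulSn addnCA addnC per ?IH // (leq_trans le_in) ?leq_addr.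
(* The exponent of [x] is [i.+1 * (j - i)], a multiple of the period that lies beyond the preperiod;
   the predecessor reflects that [pw x n] is [x^(n+1)]. *)
exists ((i.+1 * (j - i)).-1); rewrite pwD -addnS prednK; last by nia.
by rewrite perM //; nia.
Qed.

Lemma RrelS x y : Rrel mul x y -> Rrel mul y x. Proof. by case. Qed.

Lemma Rrel_refl x : Rrel mul x x. Proof. by split; exists None. Qed.

Lemma Rrel_trans y x z : Rrel mul x y -> Rrel mul y z -> Rrel mul x z.
Proof.
have rmD u s t : exists r, rm mul (rm mul u s) t = rm mul u r.
  case: s t => [s|] [t|]; [exists (Some (s ** t)) | exists (Some s)
    | exists (Some t) | exists None]; by rewrite //= mulA.
case=> [[s sE] [s' s'E]] [[t tE] [t' t'E]]; split.
  by have [r rE] := rmD x s t; exists r; rewrite tE sE.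
by have [r rE] := rmD z t' s'; exists r; rewrite s'E t'E.
Qed.

Lemma Rrel_mull u x y : Rrel mul x y -> Rrel mul (u ** x) (u ** y).
Proof.
by case=> [[s ->] [t]] => xE; split; [exists s | exists t; rewrite {1}xE];
   rewrite -[u ** _]/(lm mul (Some u) _) -rm_lm.
Qed.

Variables (I J : {set T}).
Hypothesis jc : jclass mul I J.

Lemma inIr x y : x \in I -> x ** y \in I.
Proof. by move=> xI; have [_ idI] := jclass_ideal jc; case: (idI y x (in_setT _) xI). Qed.

Lemma inIl x y : y \in I -> x ** y \in I.
Proof. by move=> yI; have [_ idI] := jclass_ideal jc; case: (idI x y (in_setT _) yI). Qed.

Lemma JmulE x y : (x \in J) || (y \in J) -> (x ** y \in J) = (x ** y \notin I).
Proof.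
move=> xyJ; apply/idP/idP; first exact: jclass_disj jc _.
have [_ id] := jclass_idealU jc; move=> /negPf nI.
suff : x ** y \in I :|: J by rewrite in_setU nI.
case/orP: xyJ => h.
  by apply: (id y x _ _).2; rewrite ?inS ?h ?orbT.
by apply: (id x y _ _).1; rewrite ?inS ?h ?orbT.
Qed.

Lemma rm_in x s : x \in J -> rm mul x s \notin I -> rm mul x s \in J.
Proof. by move=> xJ; case: s => [s|] //=; rewrite JmulE ?xJ. Qed.

Lemma rm_notin x s : rm mul x s \notin I -> x \notin I.
Proof. by case: s => [s|] //=; apply: contra => ?; apply: inIr. Qed.

(** Stability of finite semigroups: [x] and [x ** s] lie in one J-class, so [x = p x s q], and
    recurrence removes [p], giving [x = x (s q)^k] with [k] positive. *)
Lemma stabR x s : x \in J -> x ** s \notin I -> exists t, x = x ** s ** t.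
Proof.
move=> xJ xsI; have xsJ : x ** s \in J by rewrite JmulE ?xJ.
have [p [q xE]] := jclass_conn jc xsJ xJ.
have [|k k0 kE] := @iter_recurrent (lm mul p) (fun y => rm mul (y ** s) q) x _ (esym xE).
  by move=> y; rewrite -rm_lm // -[y ** s]/(rm mul y (Some s)) -rm_lm.
suff [[t|] tE] : exists t, iter k (fun y => rm mul (y ** s) q) x = rm mul (x ** s) t.
- by exists t; rewrite -[LHS]kE tE.
(* Here [x = x ** s], so [s] itself serves as [t]. *)
- by exists s; rewrite -[LHS]kE tE /= -[in LHS]kE tE.
case: k k0 {kE} => // k _; elim: k => [|k [t /= ->]]; first by exists q.
case: t q {xE} => [t|] [q|] /=.
- by exists (Some (t ** s ** q)); rewrite /= !mulA.
- by exists (Some (t ** s)); rewrite /= !mulA.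
- by exists (Some (s ** q)); rewrite /= !mulA.
- by exists (Some s).
Qed.

Lemma R_mulr x s : x \in J -> x ** s \notin I -> Rrel mul (x ** s) x.
Proof.
move=> xJ /(stabR xJ)[t xE]; split; first by exists (Some t).
by exists (Some s).
Qed.

Lemma R_mul3 x z y : x \in J -> mul3 x z y \notin I -> Rrel mul (mul3 x z y) x.
Proof. by case: z => [c|] /= xJ; rewrite -?mulA; apply: R_mulr. Qed.

Lemma R_rm x s : x \in J -> rm mul x s \notin I -> Rrel mul (rm mul x s) x.
Proof. by case: s => [s|] /= xJ; [apply: R_mulr | move=> _; apply: Rrel_refl]. Qed.

Lemma R_inI x y : Rrel mul x y -> (x \in I) = (y \in I).
Proof.
suff imp u v : Rrel mul u v -> u \in I -> v \in I.
  by move=> Rxy; apply/idP/idP; apply: imp => //; apply: RrelS.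
by case=> [[[s|] ->] _] // uI; apply: inIr.
Qed.

Lemma R_inJ x y : Rrel mul x y -> x \in J -> y \in J.
Proof.
move=> Rxy xJ; have := jclass_disj jc xJ; rewrite (R_inI Rxy).
by case: Rxy => [[s ->] _]; apply: rm_in.
Qed.

Lemma R_mulI u x y : Rrel mul x y -> (u ** x \in I) = (u ** y \in I).
Proof. by move=> Rxy; apply: R_inI; apply: Rrel_mull. Qed.

(* The H-class of [y] is a group; [g] is the inverse of [y] in it. *)
Lemma group_inverse y : y \in J -> y ** y \notin I ->
  exists g, [/\ g ** y = y ** g, g ** y ** y = y & g ** y ** g = g].
Proof.
move=> yJ yyI.
have [t yE] := stabR yJ yyI.
have [||k k0 kE] := @iter_recurrent (fun x => x ** t) (fun x => y ** x) y.
- by move=> x; rewrite mulA.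
- by rewrite -yE.
have pwk n : iter n (fun x => y ** x) y = pw y n.
  by elim: n => //= n ->; rewrite pw_comm.
(* Doubling gives [K] at least 2 while [y^(K+1) = y] still holds, so that [y^(K-1)] is a genuine
   power and serves as the inverse. *)
pose K := k + k.
have KE : pw y K = y by rewrite -pwk /K iterD !kE.
have K2 : 1 < K by rewrite /K; lia.
have K2E : K = (K - 2).+2 by lia.
exists (pw y (K - 2)); split; first by rewrite pw_comm.
  by rewrite -[RHS]KE [in RHS]K2E.
rewrite -[pw y (K - 2) ** y]/(pw y (K - 2).+1) pwD.
have -> : ((K - 2).+1 + (K - 2)).+1 = K - 2 + K by lia.
by rewrite pw_add KE.
Qed.

End Basics.

(** * The dual facts for L-classes *)

Section LeftBasics.
Variables (T : finType) (mul : T -> T -> T).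
Hypothesis mulA : associative mul.
Local Infix "**" := mul (at level 40, left associativity).
Local Notation mul3 := (mul3 mul).

Lemma LrelS x y : Lrel mul x y -> Lrel mul y x. Proof. by case. Qed.

Lemma Lrel_refl x : Lrel mul x x. Proof. by split; exists None. Qed.

Lemma Lrel_trans y x z : Lrel mul x y -> Lrel mul y z -> Lrel mul x z.
Proof. exact: (Rrel_trans (opmA mulA)). Qed.

Variables (I J : {set T}).
Hypothesis jc : jclass mul I J.
Let jo := jclass_op mulA jc.

Lemma stabL s x : x \in J -> s ** x \notin I -> exists t, x = t ** (s ** x).
Proof. exact: (stabR (opmA mulA) jo). Qed.

Lemma L_mull s x : x \in J -> s ** x \notin I -> Lrel mul (s ** x) x.
Proof. exact: (R_mulr (opmA mulA) jo). Qed.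

Lemma L_mul3 x z y : y \in J -> mul3 x z y \notin I -> Lrel mul (mul3 x z y) y.
Proof. by rewrite -mul3_op //; apply: (R_mul3 (opmA mulA) jo). Qed.

Lemma L_mulI u x y : Lrel mul x y -> (x ** u \in I) = (y ** u \in I).
Proof. exact: (R_mulI (opmA mulA) jo). Qed.

Lemma lm_in p x : x \in J -> lm mul p x \notin I -> lm mul p x \in J.
Proof. exact: (rm_in jo). Qed.

Lemma L_lm p x : x \in J -> lm mul p x \notin I -> Lrel mul (lm mul p x) x.
Proof. exact: (R_rm (opmA mulA) jo). Qed.

Lemma mul3_inI c c' z d d' : Lrel mul c c' -> Rrel mul d d' ->
  (mul3 c z d \in I) = (mul3 c' z d' \in I).
Proof.
move=> Lc Rd; case: z => [e|] /=; last by rewrite (L_mulI _ Lc) (R_mulI mulA jc _ Rd).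
by rewrite -mulA (L_mulI _ Lc) mulA (R_mulI mulA jc _ Rd).
Qed.

End LeftBasics.

(** * Wandering pairs inside a J-class *)

Section JTheory.
Variables (T : finType) (mul : T -> T -> T).
Hypothesis mulA : associative mul.
Local Infix "**" := mul (at level 40, left associativity).
Local Notation mul3 := (mul3 mul).
Variables (I J : {set T}).
Hypothesis jc : jclass mul I J.
Hypothesis tm : tame mul.
Let nI := jclass_disj jc.
Local Notation Rrel := (Rrel mul).
Local Notation Lrel := (Lrel mul).
Local Notation wan := (wan mul).

Lemma in_setTD x : (x \in [set: T] :\: I) = (x \notin I).
Proof. by rewrite !inS andbT. Qed.

Lemma in1_setT (z : option T) : in1 setT z.
Proof. by case: z => //= c; rewrite in_setT. Qed.

(* Two L-classes multiplying a given R-class through the same [z] swap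
   forever, since left factors keep R-classes and right factors L-classes. *)
Lemma wan_two_L u x v z c d : v \in J -> ~ Lrel u x ->
  mul3 u z v \notin I -> mul3 x z v \notin I ->
  Rrel c v -> Lrel c u -> Rrel d v -> Lrel d x -> wan setT I c d.
Proof.
move=> vJ nL uzv xzv Rc Lc Rd Ld.
exists (fun c d => Rrel c v /\ Rrel d v /\
  (Lrel c u /\ Lrel d x \/ Lrel c x /\ Lrel d u)); first by split=> //; split=> //; left.
move=> {Rc Lc Rd Ld} {}c {}d [Rc [Rd LL]].
have cJ : c \in J := R_inJ jc (RrelS Rc) vJ.
have dJ : d \in J := R_inJ jc (RrelS Rd) vJ.
rewrite !in_setTD !nI //.
have neq : c != d.
  apply/eqP => eq_cd; case: LL; rewrite eq_cd => -[L1 L2]; apply: nL.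
    exact: Lrel_trans (LrelS L1) L2.
  exact: Lrel_trans (LrelS L2) L1.
split=> //; exists z; first exact: in1_setT.
have czd : mul3 c z d \notin I by case: LL => -[L1 L2]; rewrite (mul3_inI mulA jc _ L1 Rd).
have dzc : mul3 d z c \notin I by case: LL => -[L1 L2]; rewrite (mul3_inI mulA jc _ L2 Rc).
split; first exact: Rrel_trans (R_mul3 mulA jc cJ czd) Rc.
split; first exact: Rrel_trans (R_mul3 mulA jc dJ dzc) Rd.
have Lcd := L_mul3 mulA jc dJ czd; have Ldc := L_mul3 mulA jc cJ dzc.
case: LL => -[L1 L2]; [right | left]; split.
- exact: Lrel_trans Lcd L2.
- exact: Lrel_trans Ldc L1.
- exact: Lrel_trans Lcd L2.
- exact: Lrel_trans Ldc L1.
Qed.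

(** By stability some [h] undoes left multiplication by [g] on the R-class of [x]. Replacing each
    multiplier [z] by [z h] cancels the inner [g], so the translated run is [g] times the original
    one. *)
Lemma wan_translate g x y : x \in J -> wan setT I x y -> Rrel x y ->
  g ** x \notin I -> wan setT I (g ** x) (g ** y).
Proof.
move=> xJ [P Pxy wP] [[s yE] _] gxI; have [h xE] := stabL mulA jc xJ gxI.
have hy : h ** (g ** y) = y.
  rewrite yE -[g ** _]/(lm mul (Some g) _) -rm_lm // -[h ** _]/(lm mul (Some h) _).
  by rewrite -rm_lm //= -xE.
exists (fun a b => exists a0 b0, [/\ P a0 b0, a = g ** a0, b = g ** b0,
   h ** a = a0 & h ** b = b0]); first by exists x, y; split.
move=> a b [a0 [b0 [/wP[neq aI bI [z _ Pz]] aE bE ha hb]]].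
rewrite !in_setTD in aI bI *; split.
- by apply: contraNneq neq => eq_ab; rewrite -ha -hb eq_ab.
- by apply: contra aI => aI; rewrite -ha (inIl jc).
- by apply: contra bI => bI; rewrite -hb (inIl jc).
pose z' := if z is Some c then c ** h else h.
exists (Some z'); first exact: in1_setT.
exists (mul3 a0 z b0), (mul3 b0 z a0).
have eqz u v u0 v0 : u = g ** u0 -> h ** v = v0 -> mul3 u (Some z') v = g ** mul3 u0 z v0.
  by move=> -> <-; rewrite /z'; case: (z) => [c|] /=; rewrite !mulA.
have eqh u v u0 v0 : h ** u = u0 -> h ** v = v0 ->
    h ** (mul3 u (Some z') v) = mul3 u0 z v0.
  by move=> <- <-; rewrite /z'; case: (z) => [c|] /=; rewrite !mulA.
by split=> //; [apply: eqz | apply: eqz | apply: eqh | apply: eqh].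
Qed.

(** Write [u = p x q] and translate the pair by [p]. The products of [p x] with [p x] and with [p y]
    are R-related, so tameness keeps both out of [I]; since [p x] is L-related to [x] and R-related
    to [u], also [x ** u] avoids [I]. *)
Lemma wan_row x y u : x \in J -> wan setT I x y -> Rrel x y -> u \in J ->
  x ** u \notin I.
Proof.
move=> xJ w Rxy uJ; have [p [q uE]] := jclass_conn jc xJ uJ.
rewrite -rm_lm // in uE.
have pxI : lm mul p x \notin I by apply: (rm_notin jc (s := q)); rewrite -uE nI.
have pxJ := lm_in mulA jc xJ pxI.
have wp : wan setT I (lm mul p x) (lm mul p y).
  by case: p {uE pxJ} pxI => [p|] //=; apply: wan_translate.
have Rp : Rrel (lm mul p x) (lm mul p y).
  by case: p {uE pxJ wp pxI} => [p|] //=; apply: Rrel_mull.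
have [_ n2 _] := tm (jclass_ideal jc) wp.
have ppI : lm mul p x ** lm mul p x \notin I.
  by apply/negP => h; apply: n2; rewrite -(R_mulI mulA jc _ Rp).
rewrite {1}uE (R_mulI mulA jc _ (R_rm mulA jc pxJ _)); last by rewrite -uE nI.
by rewrite -(L_mulI mulA jc _ (L_lm mulA jc xJ pxI)).
Qed.

(** The H-class is a group; translating by the inverse [g] of [y] turns the second entry into the
    identity [g ** y], which commutes with [g ** x], against tameness. *)
Lemma wan_not_H x y : x \in J -> wan setT I x y -> Rrel x y -> Lrel x y -> False.
Proof.
move=> xJ w Rxy Lxy; have yJ := R_inJ jc Rxy xJ.
have yyI := wan_row yJ (wan_sym w) (RrelS Rxy) yJ.
have [g [gy gyy gyg]] := group_inverse mulA jc yJ yyI.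
have gyI : g ** y \notin I by apply: contra (nI yJ) => h; rewrite -gyy (inIr jc).
have gxI : g ** x \notin I by rewrite (R_mulI mulA jc _ Rxy).
have [nc _ _] := tm (jclass_ideal jc) (wan_translate xJ w Rxy gxI).
apply: nc; rewrite (mulA (g ** y)) gyg.
have [_ [t xE]] := Lxy.
have ye : y ** (g ** y) = y by rewrite mulA -gy gyy.
suff xe : x ** (g ** y) = x by rewrite -mulA xe.
by rewrite xE; case: (t) => [s|] //=; rewrite -mulA ye.
Qed.

(* If [u v] fell into [I], the L-classes of [u] and [x] would wander over the
   R-class of [v] starting from a pair whose products vanish. *)
Lemma wan_R_closed x y u v : x \in J -> wan setT I x y -> Rrel x y ->
  u \in J -> v \in J -> u ** v \in J.
Proof.
move=> xJ w Rxy uJ vJ; have row t : t \in J -> x ** t \notin I := wan_row xJ w Rxy.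
rewrite (JmulE jc) ?uJ //; apply/negP => uvI.
have nL : ~ Lrel u x.
  by move=> Lux; have := row v vJ; rewrite -(L_mulI mulA jc _ Lux) uvI.
have [k kJ ukI] : exists2 k, k \in J & u ** k \notin I.
  have [p [q xE]] := jclass_conn jc uJ xJ.
  have xxI := row x xJ; rewrite {1}xE in xxI.
  have uqI : rm mul u q ** x \notin I.
    case: p {xE} xxI => [p|] //=.
    by rewrite -mulA; apply: contra => ?; apply: (inIl jc).
  case: q {xE xxI} uqI => [q|] /=; last by exists x.
  rewrite -mulA => uqI; exists (q ** x) => //; rewrite (JmulE jc) ?xJ ?orbT //.
  by apply: contra uqI => ?; apply: (inIl jc).
have LR a b : a \in J -> b \in J -> exists2 c, c \in J & Rrel c b /\ Lrel c a.
  move=> aJ bJ; have [p [q bE]] := jclass_conn jc aJ bJ.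
  rewrite -rm_lm // in bE.
  have paI : lm mul p a \notin I by apply: (rm_notin jc (s := q)); rewrite -bE nI.
  have paJ := lm_in mulA jc aJ paI.
  exists (lm mul p a) => //; split; last exact: (L_lm mulA jc).
  by apply: RrelS; rewrite bE; apply: (R_rm mulA jc) => //; rewrite -bE nI.
have [a aJ [Ra La]] := LR u v uJ vJ.
have [b bJ [Rb Lb]] := LR x v xJ vJ.
(* The R-class of [k] keeps [u ** z] outside [I], and the L-class of [x] lets [z] multiply every
   element of [J] without vanishing. *)
have [z zJ [Rz Lz]] := LR x k xJ kJ.
have uzI : u ** z \notin I by rewrite (R_mulI mulA jc _ Rz).
have uzv : mul3 u (Some z) v \notin I.
  rewrite /= (L_mulI mulA jc _ (L_mull mulA jc zJ uzI)) (L_mulI mulA jc _ Lz).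
  exact: row.
have xzv : mul3 x (Some z) v \notin I.
  rewrite /= (L_mulI mulA jc _ (L_mull mulA jc zJ (row z zJ))) (L_mulI mulA jc _ Lz).
  exact: row.
have wab := wan_two_L vJ nL uzv xzv Ra La Rb Lb.
have [_ n2 _] := tm (jclass_ideal jc) wab; apply: n2.
by rewrite !(L_mulI mulA jc _ La) (R_mulI mulA jc _ Ra) (R_mulI mulA jc _ Rb).
Qed.

End JTheory.

(** * J-classes with non-nilpotent principal factor *)

Section NonNilpotentFactor.
Variables (T : finType) (mul : T -> T -> T).
Hypothesis mulA : associative mul.
Local Infix "**" := mul (at level 40, left associativity).
Local Notation mul3 := (mul3 mul).
Variables (I J : {set T}).
Hypothesis jc : jclass mul I J.
Hypothesis tm : tame mul.
Let nI := jclass_disj jc.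
Local Notation Rrel := (Rrel mul).
Local Notation Lrel := (Lrel mul).
Local Notation wan := (wan mul).

Lemma wan_L_closed x y u v : x \in J -> wan setT I x y -> Lrel x y ->
  u \in J -> v \in J -> u ** v \in J.
Proof.
move=> xJ w Lxy uJ vJ.
exact: (wan_R_closed (opmA mulA) (jclass_op mulA jc) (tame_op mulA tm) xJ
  (@wan_op T (opm mul) (opmA mulA) setT I x y w) Lxy vJ uJ).
Qed.

(** One of the first two multipliers of the run works. An element [c] used there is nonzero next to
    [x] and [y], hence lies in [J], and [y ** c] and [x ** c] are L-related to [c]. If both
    multipliers are the identity, so is the chosen one. *)
Lemma wan_common_multiplier x y : wan (I :|: J) I x y ->
  exists2 z, mul3 x z x \notin I & mul3 y z x \notin I.
Proof.
have dec u : u \in (I :|: J) :\: I -> u \in J.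
  by rewrite !inS => /andP[/negPf->].
have nIl a b : a ** b \notin I -> a \notin I by apply: contra => ?; apply: (inIr jc).
have nIr a b : a ** b \notin I -> b \notin I by apply: contra => ?; apply: (inIl jc).
have via c : c \in I :|: J -> x \in J -> x ** c \notin I -> c ** x \notin I ->
    y ** c \notin I -> y ** c ** x \notin I /\ x ** c ** x \notin I.
  rewrite in_setU => cIJ xJ xc cx yc.
  have cJ : c \in J by case/orP: cIJ => // cI; case/negP: cx; apply: (inIr jc).
  by rewrite !(L_mulI mulA jc _ (L_mull mulA jc cJ _)).
case/wanP=> _ /dec xJ /dec yJ [z zA w]; have [_ /dec/nI l1 /dec/nI r1 [z1 z1A]] := wanP w.
case: z zA l1 r1 {w} => [c|] /= cA l1 r1.
  move=> _; have [] := via c cA xJ (nIl _ _ l1); last by move=> *; exists (Some c).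
    by move: r1; rewrite -mulA => /nIr.
  exact: nIl r1.
case/wanP=> _ /dec/nI l2 /dec/nI r2 _.
case: z1 z1A l2 r2 => [c|] /= c1A l2 r2.
  have [] := via c c1A xJ.
  - by move: r2 => /nIl; rewrite -mulA => /nIr.
  - by move: r2; rewrite -!mulA => /nIr/nIr; rewrite mulA => /nIl.
  - by move: l2 => /nIl; rewrite -mulA => /nIr.
  by exists (Some c).
exists None => //=; by move: r2; rewrite -mulA => /nIr; rewrite mulA => /nIl.
Qed.

Theorem nonnilpotent_factor : ~ nilpotent_mod mul (I :|: J) I ->
  {in J &, forall u v, u ** v \in J} /\
  exists x y, [/\ x \in J, y \in J & ~ Rrel x y \/ ~ Lrel x y].
Proof.
move=> nnil; have [_ idIJ] := jclass_idealU jc.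
have cA : sg_closed mul (I :|: J).
  by apply/forall_inP => x _; apply/forall_inP => y yA; apply: (idIJ _ _ (in_setT x) yA).1.
have idA : is_ideal_in mul (I :|: J) I.
  split; first exact: subsetUl.
  by move=> a x _ xI; split; [apply: (inIl jc) | apply: (inIr jc)].
have [x [y wA]] := non_nilpotent_wan cA idA nnil.
have w : wan setT I x y by apply: wan_sub wA; [apply: subsetT | apply: subxx].
have [xJ yJ] : x \in J /\ y \in J.
  by case: (wanP wA) => _; rewrite !inS => /andP[/negPf->] /= -> /andP[/negPf->].
have notH : ~ (Rrel x y /\ Lrel x y).
  by case=> *; apply: (wan_not_H mulA jc tm xJ w).
split; last by exists x, y; split=> //; apply: not_and_or.
move=> u v uJ vJ.
have [Rxy|nR] := classic (Rrel x y); first exact: (wan_R_closed mulA jc tm xJ w).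
have [Lxy|nL] := classic (Lrel x y); first exact: (wan_L_closed xJ w).
have [z xzx yzx] := wan_common_multiplier wA.
have [_ _ _ [z0 _ /wanP[_]]] := wanP w.
rewrite !in_setTD => l1 _ _.
have R1 := R_mul3 mulA jc xJ l1; have L1 := L_mul3 mulA jc yJ l1.
(* When [x] and [y] share neither class, [x] and its successor [x z0 y] lie in one R-class but in
   distinct L-classes, which gives a wandering pair inside an R-class. *)
have w1 := wan_two_L mulA jc xJ nL xzx yzx (Rrel_refl _ x) (Lrel_refl _ x) R1 L1.
exact: (wan_R_closed mulA jc tm xJ w1 (RrelS R1)).
Qed.

End NonNilpotentFactor.

(** * Elements acting on a closed J-class *)

Section Acting.
Variables (T : finType) (mul : T -> T -> T).
Hypothesis mulA : associative mul.
Local Infix "**" := mul (at level 40, left associativity).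
Variables (I J : {set T}).
Hypothesis jc : jclass mul I J.
Hypothesis tm : tame mul.
Hypothesis clJ : {in J &, forall u v, u ** v \in J}.
Let nI := jclass_disj jc.

Definition acts a := forall t, t \in J -> a ** t \in J /\ t ** a \in J.

(** If [a ** v] is in [J], closure gives [u ** (a ** v)] in [J], so [u ** a] is nonzero for every
    [u] in [J]; the mirrored argument then returns to [a ** u]. *)
Lemma acts_nonzero a t : t \in J -> (a ** t \notin I) || (t ** a \notin I) -> acts a.
Proof.
have toR v : v \in J -> a ** v \notin I -> forall u, u \in J -> u ** a \in J.
  move=> vJ avI u uJ; have : u ** (a ** v) \in J.
    by apply: clJ; rewrite // (JmulE jc) ?vJ ?orbT.
  rewrite mulA => /nI k; rewrite (JmulE jc) ?uJ //.
  by apply: contra k => ?; apply: (inIr jc).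
have toL v : v \in J -> v ** a \notin I -> forall u, u \in J -> a ** u \in J.
  move=> vJ vaI u uJ; have : v ** a ** u \in J.
    by apply: clJ; rewrite // (JmulE jc) ?vJ.
  rewrite -mulA => /nI k; rewrite (JmulE jc) ?uJ ?orbT //.
  by apply: contra k => ?; apply: (inIl jc).
move=> tJ /orP[/(toR t tJ) hR|/(toL t tJ) hL] u uJ.
  by split; [apply: (toL u uJ (nI (hR u uJ)) u uJ) | apply: hR].
by split; [apply: hL | apply: (toR u uJ (nI (hL u uJ)) u uJ)].
Qed.

Lemma acts_in a : a \in J -> acts a.
Proof. by move=> aJ t tJ; split; apply: clJ. Qed.

Lemma actsM a b : acts a -> acts b -> acts (a ** b).
Proof.
by move=> ha hb t tJ; rewrite mulA -mulA; split; [apply/(ha _ _).1/(hb _ tJ).1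
  | apply/(hb _ _).2/(ha _ tJ).2].
Qed.

Lemma acts_factor a b t : t \in J -> acts (a ** b) -> acts a /\ acts b.
Proof.
move=> tJ h; case: (h t tJ) => /nI h1 /nI h2; split; apply: (acts_nonzero tJ).
  by rewrite orbC; apply/orP; left; apply: contra h2; rewrite mulA => ?; apply: (inIr jc).
by apply/orP; left; apply: contra h1; rewrite -mulA => ?; apply: (inIl jc).
Qed.

Lemma acts_pw a n : acts a -> acts (pw mul a n).
Proof. by move=> ha; elim: n => //= n IH; apply: actsM. Qed.

(* R-classes of left factors are preserved and [J] is closed, so two elements
   of [J] in different R-classes never merge. *)
Lemma acting_wan_R a b z : acts a -> b \in J -> z \in J -> ~ Rrel mul (a ** z) b ->
  wan mul setT I a b.
Proof.
move=> ha bJ zJ nR; have azJ := (ha z zJ).1.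
have stepR u v : u \in J -> u ** v \in J -> Rrel mul (u ** v) u.
  by move=> uJ uvJ; apply: (R_mulr mulA jc) => //; apply: nI.
(* The initial pair is listed apart because [a] may lie outside [J]; the multiplier [z] brings both
   entries into [J], and from there the identity suffices. *)
exists (fun c d => (c = a /\ d = b) \/ [/\ c \in J, d \in J & ~ Rrel mul c d]); first by left.
move=> c d [[-> ->]|[cJ dJ nRcd]]; rewrite !in_setTD.
  split.
  - by apply/eqP => eq_ab; apply: nR; rewrite eq_ab; apply: stepR => //; apply: clJ.
  - by apply: contra (nI azJ) => ?; apply: (inIr jc).
  - exact: nI.
  exists (Some z); first by rewrite /= in_setT.
  have bzaJ : b ** z ** a \in J by apply: (ha _ _).2; apply: clJ.
  have azbJ : a ** z ** b \in J by apply: clJ.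
  right; split=> //= R2; apply: nR.
  apply: (Rrel_trans mulA) (RrelS (stepR _ _ azJ azbJ)) _.
  by apply: (Rrel_trans mulA) R2 _; rewrite -mulA; apply: stepR; rewrite // mulA.
split; rewrite ?nI //; first by apply: contra_notN nRcd => /eqP->; apply: Rrel_refl.
have cdJ := clJ cJ dJ; have dcJ := clJ dJ cJ.
exists None => //; right; split=> // R2; apply: nRcd.
apply: (Rrel_trans mulA) (RrelS (stepR _ _ cJ cdJ)) _.
by apply: (Rrel_trans mulA) R2 _; apply: stepR.
Qed.

Lemma commuting_R a l z : acts a -> l \in J -> a ** l = l ** a -> z \in J ->
  Rrel mul (a ** z) l.
Proof.
move=> ha lJ al zJ; apply: NNPP => nR.
by have [] := tm (jclass_ideal jc) (acting_wan_R ha lJ zJ nR).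
Qed.

(** The product [a ** x] cannot be R-related to both [x] and [y]; one to which it is not related
    serves as [b]. *)
Lemma acting_partner_R a x y : acts a -> x \in J -> y \in J -> ~ Rrel mul x y ->
  exists b, wan mul setT I a b.
Proof.
move=> ha xJ yJ nR; have [Rx|nRx] := classic (Rrel mul (a ** x) x).
  exists y; apply: (acting_wan_R ha yJ xJ) => Ry; apply: nR.
  exact: (Rrel_trans mulA) (RrelS Rx) Ry.
by exists x; apply: (acting_wan_R ha xJ xJ).
Qed.

End Acting.

(** * Constancy of the action on R- and L-classes *)

Section ActingConstant.
Variables (T : finType) (mul : T -> T -> T).
Hypothesis mulA : associative mul.
Local Infix "**" := mul (at level 40, left associativity).
Variables (I J : {set T}).
Hypothesis jc : jclass mul I J.
Hypothesis tm : tame mul.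
Hypothesis clJ : {in J &, forall u v, u ** v \in J}.
Let nI := jclass_disj jc.
Let clJo : {in J &, forall u v, opm mul u v \in J}.
Proof. by move=> u v uJ vJ; apply: clJ. Qed.

Lemma acts_op a : acts mul J a -> acts (opm mul) J a.
Proof. by move=> ha t /ha[]. Qed.

Lemma commuting_L a l z : acts mul J a -> l \in J -> a ** l = l ** a -> z \in J ->
  Lrel mul (z ** a) l.
Proof.
move=> ha lJ al zJ.
exact: (commuting_R (opmA mulA) (jclass_op mulA jc) (tame_op mulA tm) clJo
         (acts_op ha) lJ (esym al) zJ).
Qed.

(* With [e] the idempotent power of [a], the identity of a maximal subgroup
   inside [e J e] commutes with [a]. *)
Lemma commuting_element a t : acts mul J a -> t \in J ->
  exists2 l, l \in J & a ** l = l ** a.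
Proof.
move=> ha tJ; have [n ee] := idempotent_power mulA a.
set e := pw mul a n in ee; have he : acts mul J e := acts_pw mulA n ha.
have ae : a ** e = e ** a := pw_comm mulA a n.
pose l0 := e ** t ** e.
have l0J : l0 \in J by apply: (he _ (he _ tJ).1).2.
have [g [gl gll glg]] := group_inverse mulA jc l0J (nI (clJ l0J l0J)).
pose l := g ** l0.
have lJ : l \in J.
  rewrite (JmulE jc) ?l0J ?orbT //.
  by apply: contra (nI l0J) => lI; rewrite -gll (inIr jc).
have ll : l ** l = l by rewrite {2}/l mulA glg.
have el : e ** l = l by rewrite /l gl /l0 !mulA ee.
have le : l ** e = l by rewrite /l /l0 -!mulA ee.
have [alJ laJ] := ha _ lJ.
(* The idempotent [e] acts on [J] and commutes with [l], so [e (a l)] is R-related to [l]; it equals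
   [a l] because [a] commutes with [e]. *)
have Ral : Rrel mul l (a ** l).
  apply: RrelS; have -> : a ** l = e ** (a ** l) by rewrite mulA -ae -mulA el.
  exact: (commuting_R mulA jc tm clJ he lJ (etrans el (esym le)) alJ).
have Lla : Lrel mul l (l ** a).
  apply: LrelS; have -> : l ** a = l ** a ** e by rewrite -mulA ae mulA le.
  exact: (commuting_L he lJ (etrans el (esym le)) laJ).
clearbody l; exists l => //; have [[s alE] _] := Ral; have [[s' laE] _] := Lla.
(* The idempotent [l] is a left identity on its R-class, which contains [a l], and a right identity
   on its L-class, which contains [l a]. *)
transitivity (l ** a ** l).
  by rewrite -mulA alE; case: (s) => [c|] /=; rewrite ?mulA ll.
by rewrite laE; case: (s') => [c|] /=; rewrite -?mulA ll.
Qed.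

(** Both products are R-related to an element of [J] commuting with [a]. This makes the first index
    of [Phi] well defined. *)
Lemma acts_const_R a s t : acts mul J a -> s \in J -> t \in J ->
  Rrel mul (a ** s) (a ** t).
Proof.
move=> ha sJ tJ; have [l lJ al] := commuting_element ha sJ.
apply: (Rrel_trans mulA) (RrelS _); exact: (commuting_R mulA jc tm clJ ha lJ al).
Qed.

(** Right multiplication by the identity [g ** y] of the group H-class of [y] fixes [y] and moves
    the multiplier into [J], where the Rees product formula applies. *)
Lemma Rrel_mul_in x y : x \in J -> y \in J -> Rrel mul x y ->
  exists2 s, s \in J & y = x ** s.
Proof.
move=> xJ yJ [[s yE] _].
have [g [gy gyy _]] := group_inverse mulA jc yJ (nI (clJ yJ yJ)).
have gyJ : g ** y \in J.
  rewrite (JmulE jc) ?yJ ?orbT //.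
  by apply: contra (nI yJ) => lI; rewrite -gyy (inIr jc).
have ye : y ** (g ** y) = y by rewrite mulA -gy gyy.
case: s yE => [s|] /= yE; last by exists (g ** y) => //; rewrite -yE.
have yE' : y = x ** (s ** (g ** y)) by rewrite mulA -yE.
exists (s ** (g ** y)) => //; rewrite (JmulE jc) ?gyJ ?orbT //.
by apply: contra (nI yJ) => h; rewrite yE' (inIl jc).
Qed.

End ActingConstant.

Section ActingConstantL.
Variables (T : finType) (mul : T -> T -> T).
Hypothesis mulA : associative mul.
Local Infix "**" := mul (at level 40, left associativity).
Variables (I J : {set T}).
Hypothesis jc : jclass mul I J.
Hypothesis tm : tame mul.
Hypothesis clJ : {in J &, forall u v, u ** v \in J}.
Let clJo : {in J &, forall u v, opm mul u v \in J}.
Proof. by move=> u v uJ vJ; apply: clJ. Qed.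

Lemma acts_const_L a s t : acts mul J a -> s \in J -> t \in J ->
  Lrel mul (s ** a) (t ** a).
Proof.
move=> ha sJ tJ.
exact: (acts_const_R (opmA mulA) (jclass_op mulA jc) (tame_op mulA tm) clJo (acts_op ha) sJ tJ).
Qed.

Lemma Lrel_mul_in x y : x \in J -> y \in J -> Lrel mul x y ->
  exists2 s, s \in J & y = s ** x.
Proof.
move=> xJ yJ Lxy.
exact: (Rrel_mul_in (opmA mulA) (jclass_op mulA jc) clJo xJ yJ Lxy).
Qed.

Lemma acting_partner_L a x y : acts mul J a -> x \in J -> y \in J ->
  ~ Lrel mul x y -> exists b, wan mul setT I a b.
Proof.
move=> ha xJ yJ nL.
have [b w] := acting_partner_R (opmA mulA) (jclass_op mulA jc) clJo (acts_op ha) xJ yJ nL.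
by exists b; apply: wan_op w.
Qed.

End ActingConstantL.

(** * Principal series *)

Lemma last_index (Q : nat -> Prop) m : Q 1 -> ~ Q m.+1 ->
  exists j, 1 <= j <= m /\ Q j /\ ~ Q j.+1.
Proof.
move=> Q1; elim: m => [|m IH] nQ; first by case: nQ.
have [Qm|nQm] := classic (Q m.+1); first by exists m.+1; rewrite /= leqnn.
have [j [/andP[j1 jm] H]] := IH nQm.
by exists j; split=> //; rewrite j1 leqW.
Qed.

Section Series.
Variables (T : finType) (mul : T -> T -> T).
Hypothesis mulA : associative mul.
Local Infix "**" := mul (at level 40, left associativity).
Hypothesis pn : pseudo_nilpotent mul.
Variables (m : nat) (Ss : nat -> {set T}).
Hypothesis ps : principal_series mul m Ss.
Let tm := pseudo_nilpotent_tame mulA pn.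
Local Notation D := (Dif Ss).
Local Notation Sup := (Sup mul Ss).
Local Notation gen := (sg_gen mul).
Implicit Types (i j k : nat) (a b x y : T).

Definition nonnil j := 1 <= j <= m /\ ~ nilpotent_mod mul (Ss j) (Ss j.+1).

Lemma series_ideal i : 1 <= i <= m.+1 -> is_ideal_in mul setT (Ss i).
Proof.
case: ps => _ [Sm Si] /andP[i1]; rewrite leq_eqVlt => /orP[/eqP->|im].
  by rewrite Sm; split; [apply: sub0set | move=> a x _; rewrite inE].
by case: (Si i _) => //; rewrite i1.
Qed.

Lemma series_sub i j : 1 <= i -> i <= j <= m.+1 -> Ss j \subset Ss i.
Proof.
case: ps => _ [_ Si] i1 /andP[le_ij]; elim: j le_ij => [|j IH]; first by case: i i1.
rewrite leq_eqVlt => /orP[/eqP->|]; rewrite // ltnS => le_ij jm.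
apply: subset_trans (IH le_ij (ltnW jm)).
by case: (Si j _) => [|_ [/proper_sub]]; rewrite // (leq_trans i1 le_ij).
Qed.

Lemma dif_index x : exists2 i, 1 <= i <= m & x \in D i.
Proof.
case: ps => S1 [Sm _].
have [||i [im [xi nxi]]] := @last_index (fun i => x \in Ss i) m; rewrite ?S1 ?Sm ?inE //.
by exists i => //; rewrite inE xi andbT; apply/negP.
Qed.

Lemma dif_le i j x : 1 <= i <= m -> 1 <= j <= m -> x \in D i -> x \in Ss j -> j <= i.
Proof.
move=> /andP[i1 im] /andP[j1 jm]; rewrite in_setD => /andP[/negP nxi _] xj.
rewrite leqNgt; apply/negP => lt_ij; apply: nxi.
by apply: (subsetP (@series_sub i.+1 j _ _)); rewrite ?lt_ij ?leqW.
Qed.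

Lemma dif_sub i : D i \subset Ss i. Proof. exact: subsetDl. Qed.

Lemma dif_inj i j x : 1 <= i <= m -> 1 <= j <= m -> x \in D i -> x \in D j -> i = j.
Proof.
move=> im jm xi xj; apply/eqP; rewrite eqn_leq.
by rewrite (dif_le jm im xj) ?(dif_le im jm xi) //; apply: (subsetP (dif_sub _)).
Qed.

Lemma dif_ex i : 1 <= i <= m -> exists x, x \in D i.
Proof.
case: ps => _ [_ Si] /Si[_ [/properP[_ [x xi nxi]] _]].
by exists x; rewrite in_setD nxi.
Qed.

Lemma dif_setU i : 1 <= i <= m -> Ss i.+1 :|: D i = Ss i.
Proof.
case: ps => _ [_ Si] /Si[_ [/proper_sub/setIidPr sub _]].
by rewrite -[RHS](setID _ (Ss i.+1)) sub.
Qed.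

(** The ideal generated by [a], joined with [Ss i.+1], lies between two consecutive terms of the
    series and contains [a], so it is all of [Ss i]. *)
Lemma series_jclass i : 1 <= i <= m -> jclass mul (Ss i.+1) (D i).
Proof.
move=> im; have /andP[i1 lim] := im.
have idI : is_ideal_in mul setT (Ss i.+1) by apply: series_ideal.
have idS : is_ideal_in mul setT (Ss i) by apply: series_ideal; rewrite i1 leqW.
split=> //; first by rewrite dif_setU.
  by move=> x; rewrite in_setD => /andP[].
move=> a b aD bD; have [_ [_ Si]] := ps; have [_ [_ minS]] := Si i im.
pose A := Ss i.+1 :|: [set x | [exists p, exists q, x == lm mul p (rm mul a q)]].
have lmA p c x : c ** lm mul p x = lm mul (Some (if p is Some d then c ** d else c)) x.
  by case: p => [d|] //=; rewrite mulA.
have rmA x q c : rm mul x q ** c = rm mul x (Some (if q is Some d then d ** c else c)).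
  by case: q => [d|] //=; rewrite mulA.
have idA : is_ideal_in mul setT A.
  split=> [|c x _]; first exact: subsetT.
  rewrite in_setU inE => /orP[xI|/existsP[p /existsP[q /eqP->]]].
    by have [l r] := idI.2 c x (in_setT _) xI; rewrite !in_setU l r.
  rewrite !in_setU !inE; split; apply/orP; right.
    by rewrite lmA; apply/existsP; eexists; apply/existsP; exists q.
  rewrite -rm_lm // rmA; apply/existsP; exists p; apply/existsP; eexists.
  by rewrite -rm_lm.
have aA : a \in A by rewrite in_setU inE; apply/orP; right;
  apply/existsP; exists None; apply/existsP; exists None.
have sAS : A \subset Ss i.
  apply/subsetP => x; rewrite in_setU inE.
  have aS := subsetP (dif_sub i) _ aD.
  case/orP=> [xI|/existsP[p /existsP[q /eqP->]]].
    by rewrite -dif_setU // in_setU xI.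
  have qS : rm mul a q \in Ss i by case: q => //= q; apply: (idS.2 _ _ (in_setT q) aS).2.
  by case: p => //= p; apply: (idS.2 _ _ (in_setT p) qS).1.
case: (minS A idA (subsetUl _ _) sAS) => AE.
  by move: aD; rewrite in_setD -AE aA.
have : b \in A by rewrite AE (subsetP (dif_sub i)).
move: bD; rewrite in_setD in_setU inE => /andP[/negPf-> _] /existsP[p /existsP[q /eqP->]].
by exists p, q.
Qed.

(** * Supports of the non-nilpotent factors *)

Lemma nonnil_factor i : nonnil i -> {in D i &, forall u v, u ** v \in D i} /\
  exists x y, [/\ x \in D i, y \in D i & ~ Rrel mul x y \/ ~ Lrel mul x y].
Proof.
case=> im nnil; apply: (nonnilpotent_factor mulA (series_jclass im) tm).
by rewrite dif_setU.
Qed.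

(** [Fset] asks for one nonzero product only; closure of the J-class upgrades this to an action on
    all of it. *)
Lemma nonnil_SupP j a : nonnil j -> a \in Sup j <-> acts mul (D j) a.
Proof.
move=> nj; have [jm _] := nj; have jc := series_jclass jm.
have [cl _] := nonnil_factor nj; have [t tD] := dif_ex jm.
rewrite in_setU inE; split.
  case/orP=> [/andP[_ /exists_inP[u uD h]]|aD]; last exact: acts_in.
  exact: (acts_nonzero mulA jc cl uD).
move=> ha; have [/(jclass_disj jc) atI _] := ha t tD.
have [aS|aS] := boolP (a \in Ss j); apply/orP; [right|left].
  by rewrite in_setD aS andbT; apply: contra atI => ?; apply: (inIr jc).
by apply/exists_inP; exists t => //; rewrite atI.
Qed.

(** Thus [Sup j] is a subsemigroup whose complement is an ideal, which underlies the ideal property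
    of [K] and statements (5) and (6). *)
Lemma nonnil_Sup_mul j a b : nonnil j -> (a ** b \in Sup j) = (a \in Sup j) && (b \in Sup j).
Proof.
move=> nj; have [jm _] := nj; have [t tD] := dif_ex jm; have [cl _] := nonnil_factor nj.
apply/idP/andP => [/(nonnil_SupP _ nj) h|[/(nonnil_SupP _ nj) ha /(nonnil_SupP _ nj) hb]].
  have [ha hb] := acts_factor mulA (series_jclass jm) cl tD h.
  by split; apply/(nonnil_SupP _ nj).
by apply/(nonnil_SupP _ nj); apply: actsM.
Qed.

(** Elements of one J-class divide each other, and divisors of an element of [Sup j] are in
    [Sup j]. *)
Lemma nonnil_Sup_dif j i a b : nonnil j -> 1 <= i <= m -> a \in D i -> b \in D i ->
  a \in Sup j -> b \in Sup j.
Proof.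
move=> nj im aD bD; have [p [q ->]] := jclass_conn (series_jclass im) bD aD.
case: p q => [p|] [q|] //=; rewrite !nonnil_Sup_mul //.
- by case/and3P.
- by case/andP.
by case/andP.
Qed.

Lemma Sup_index i j a : 1 <= i <= m -> 1 <= j <= m -> a \in D i -> a \in Sup j ->
  i = j \/ i < j /\ a \in Fset mul Ss j.
Proof.
move=> im jm aD; rewrite in_setU => /orP[aF|aj]; last by left; apply: dif_inj aj.
right; split=> //; move: aF; rewrite inE => /andP[naS _]; rewrite ltnNge.
apply: contra naS => le_ji; apply: subsetP (subsetP (dif_sub i) _ aD).
by case/andP: jm im => j1 _ /andP[_ im]; apply: series_sub; rewrite // le_ji leqW.
Qed.

(** A nonzero product [b] of [a] with an element of [D i2] stays in [D i2] and has a nonzero product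
    with some element of [D i3]; reassociating yields a nonzero product of [a] itself with an
    element of [D i3]. *)
Lemma Sup_trans i1 i2 i3 : 1 <= i1 <= m -> 1 <= i2 <= m -> 1 <= i3 <= m ->
  D i1 \subset Sup i2 -> D i2 \subset Sup i3 -> D i1 \subset Sup i3.
Proof.
move=> im1 im2 im3 /subsetP s12 /subsetP s23; apply/subsetP => a aD.
have [eq12|[lt12 aF]] := Sup_index im1 im2 aD (s12 a aD); first by apply: s23; rewrite -eq12.
have [t0 t0D] := dif_ex im2.
have [<-|[lt23 _]] := Sup_index im2 im3 t0D (s23 _ t0D); first exact: s12.
have naS : a \notin Ss i3.
  by apply/negP => /(dif_le im1 im3 aD); rewrite leqNgt (ltn_trans lt12).
have jc2 := series_jclass im2; have jc3 := series_jclass im3.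
rewrite in_setU inE naS /=; apply/orP; left.
have use b c : b \in D i2 -> (b = a ** c \/ b = c ** a) ->
    exists2 u, u \in D i3 & (a ** u \notin Ss i3.+1) || (u ** a \notin Ss i3.+1).
  move=> bD bE; have [eq23|[_]] := Sup_index im2 im3 bD (s23 _ bD).
    by rewrite eq23 ltnn in lt23.
  rewrite inE => /andP[_ /exists_inP[u uD]].
  have Dl v : v ** u \notin Ss i3.+1 -> v ** u \in D i3 by rewrite (JmulE jc3) ?uD ?orbT.
  have Dr v : u ** v \notin Ss i3.+1 -> u ** v \in D i3 by rewrite (JmulE jc3) ?uD.
  have nIl x y : x ** y \notin Ss i3.+1 -> x \notin Ss i3.+1.
    by apply: contra => ?; apply: (inIr jc3).
  have nIr x y : x ** y \notin Ss i3.+1 -> y \notin Ss i3.+1.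
    by apply: contra => ?; apply: (inIl jc3).
  case: bE => -> /orP[].
  - by rewrite -mulA => h; exists (c ** u); rewrite ?h // Dl //; apply: nIr h.
  - by rewrite mulA => /nIl h; exists u; rewrite ?h ?orbT.
  - by rewrite -mulA => /nIr h; exists u; rewrite ?h.
  - by rewrite mulA => h; exists (u ** c); rewrite ?h ?orbT // Dr //; apply: nIl h.
move: aF; rewrite inE => /andP[_ /exists_inP[t tD /orP[h|h]]].
  have atD : a ** t \in D i2 by rewrite (JmulE jc2) ?tD ?orbT.
  have [u uD hu] := use _ t atD (or_introl erefl).
  by apply/exists_inP; exists u.
have taD : t ** a \in D i2 by rewrite (JmulE jc2) ?tD.
have [u uD hu] := use _ t taD (or_intror erefl).
by apply/exists_inP; exists u.
Qed.

Lemma wan_edge I x y : wan mul setT I x y -> ~ sg_nilpotent mul (gen [set x; y]).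
Proof.
move=> w; have w0 : wan mul setT set0 x y by apply: wan_sub w; [apply: subxx | apply: sub0set].
have id0 : is_ideal_in mul setT set0 by split; [apply: sub0set | move=> a u _; rewrite inE].
by have := pseudo_nilpotent_wan pn id0 w0; rewrite setI0.
Qed.

(* A wandering pair of <a, b> eventually stays in one J-class [D j], on which
   both [a] and [b] must act: the powers of a single element commute. *)
Lemma edge_Sup a b : ~ sg_nilpotent mul (gen [set a; b]) ->
  exists j, [/\ nonnil j, a \in Sup j & b \in Sup j].
Proof.
move=> nnil; have [S1 [Sm _]] := ps.
have id0 A : is_ideal_in mul A set0 by split; [apply: sub0set | move=> c u _; rewrite inE].
have [x [y [P Pxy wP]]] := non_nilpotent_wan (gen_closed mul [set a; b]) (id0 _) nnil.
(* The index [j] is chosen so that [Ss j] contains a pair of the run while [Ss j.+1] contains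
   none. *)
have [||j [jm [[u [v [Puv uS vS]]] nQ]]] :=
    @last_index (fun j => exists u v, [/\ P u v, u \in Ss j & v \in Ss j]) m.
- by exists x, y; rewrite S1 !in_setT.
- by case=> u [v []]; rewrite Sm inE.
have idS : is_ideal_in mul setT (Ss j) by apply: series_ideal; case/andP: jm => -> /leqW.
have idI : is_ideal_in mul setT (Ss j.+1) by apply: series_ideal; case/andP: jm.
have abs3 (I : {set T}) c z d : is_ideal_in mul setT I -> (c \in I) || (d \in I) ->
    mul3 mul c z d \in I.
  move=> id; apply: idealM3 (id) _ _ _; rewrite ?in_setT ?in1_setT //.
  by apply/forall_inP => ? _; apply/forall_inP => ? _; rewrite in_setT.
pose P' u v := [/\ P u v, u \in Ss j & v \in Ss j].
have wP' : wander mul (gen [set a; b]) (Ss j.+1) P'.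
  rewrite /wander => c d [Pcd cS dS]; have [neq cA dA [z zA Pz]] := wP c d Pcd.
  have nI : ~ ((c \in Ss j.+1) || (d \in Ss j.+1)).
    move=> h; apply: nQ; exists (mul3 mul c z d), (mul3 mul d z c).
    by split=> //; apply: abs3 => //; rewrite orbC.
  move: cA dA; rewrite !in_setD !in_set0 /= => cA dA; rewrite cA dA !andbT.
  split=> //; try by apply/negP => h; apply: nI; rewrite h ?orbT.
  by exists z => //; split=> //; apply: abs3; rewrite ?cS ?dS.
have w : wan mul (gen [set a; b]) (Ss j.+1) u v by exists P'.
have nj : nonnil j.
  (* A nilpotent factor would make the subsemigroup generated by [u] and [v], which lies in [Ss j],
     nilpotent modulo [Ss j.+1]. *)
  split=> // nil; have wT := wan_sub (subsetT _) (subxx _) w.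
  case: (pseudo_nilpotent_wan pn idI wT); apply: nilpotent_mod_sub nil (gen_closed _ _).
  apply: gen_min; first by apply/subsetP => c; rewrite !inS => /orP[]/eqP->.
  by apply/forall_inP => c _; apply/forall_inP => d dS; apply: (idS.2 c d (in_setT _) dS).1.
have [_ uA vA [z zA]] := wP' u v (And3 Puv uS vS).
move=> /[dup] Pz /wP'[neq lA _ _].
have lD : mul3 mul u z v \in Sup j.
  case: Pz => _ lS _; rewrite in_setU in_setD lS.
  by move: lA; rewrite in_setD => /andP[-> _]; rewrite orbT.
move: uA vA; rewrite !in_setD => /andP[_ uA] /andP[_ vA].
(* A generator outside [Sup j] lies in the complementary ideal, which would then contain the unequal
   products, although the first of them lies in [D j]. *)
have key c d : gen [set a; b] = gen [set c; d] -> c \in Sup j.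
  move=> E; rewrite E in uA vA zA; apply/negPn/negP => nc.
  have absC : {in ~: Sup j & gen [set c; d],
      forall e f, (e ** f \in ~: Sup j) && (f ** e \in ~: Sup j)}.
    move=> e f; rewrite !in_setC => ne _; rewrite !nonnil_Sup_mul //.
    by rewrite (negPf ne) andbF.
  have cC : c \in ~: Sup j by rewrite in_setC.
  have /andP[] := noncommuting3_in_ideal mulA absC cC uA vA zA neq.
  by rewrite in_setC lD.
by exists j; split=> //; [apply: (key a b) | apply: (key b a); rewrite setUC].
Qed.

(** Failure to be a root gives [a] in [D j] and a deeper [b] generating a non-nilpotent
    subsemigroup; both act on a common factor [k], which lies at least as deep as [b]. *)
Lemma nonnil_root j : nonnil j -> ~ is_root mul Ss j ->
  exists k, [/\ nonnil k, j < k & D j \subset Sup k].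
Proof.
move=> nj nroot; have [jm nnil] := nj.
have [a [b [aD bS nab]]] : exists a b, [/\ a \in D j, b \in Ss j.+1 &
    ~ sg_nilpotent mul (gen [set a; b])].
  apply: NNPP => none; apply: nroot; split=> // a b aD bS; apply: NNPP => nab.
  by apply: none; exists a, b.
have [k [nk ak bk]] := edge_Sup nab; have [km _] := nk; exists k; split=> //.
  have [i im bD] := dif_index b.
  have lt_ji : j < i.
    have [lt_jm|le_mj] := ltnP j m; first exact: (dif_le im _ bD bS).
    have jE : j = m by apply/eqP; rewrite eqn_leq le_mj; case/andP: jm => _ ->.
    by move: bS; rewrite jE; case: ps => _ [-> _]; rewrite inE.
  by have [<-|[lt_ik _]] := Sup_index im km bD bk; rewrite // (ltn_trans lt_ji).
by apply/subsetP => c cD; apply: (nonnil_Sup_dif nk jm aD cD ak).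
Qed.

(** Passing from a non-root to a larger index stops because indices are bounded by [m]; [Sup_trans]
    carries [x] along. *)
Lemma Sup_root j x : nonnil j -> x \in Sup j ->
  exists k, [/\ 1 <= k <= m, is_root mul Ss k & x \in Sup k].
Proof.
have [n] := ubnP (m - j); elim: n j => // n IH j le_n nj xj; have [jm _] := nj.
have [root|nroot] := classic (is_root mul Ss j); first by exists j.
have [k [nk lt_jk sjk]] := nonnil_root nj nroot; have [km _] := nk.
apply: (IH k) => //; first by case/andP: km => _; lia.
have [i im xD] := dif_index x.
have sij : D i \subset Sup j by apply/subsetP => c cD; apply: (nonnil_Sup_dif nj im xD cD xj).
exact: subsetP (Sup_trans im jm km sij sjk) x xD.
Qed.

Lemma root_nonnil j : 1 <= j <= m -> is_root mul Ss j -> nonnil j.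
Proof. by move=> jm [nnil _]; split. Qed.

(** In the converse, the case [j = i] is not covered by the [Fset] condition; there [i] is
    non-nilpotent but no root, so a larger index takes its place. *)
Lemma not_isolatedP i x : 1 <= i <= m -> x \in D i ->
  ~ isolated mul m Ss i <-> exists j, nonnil j /\ x \in Sup j.
Proof.
move=> im xD; split.
  move=> niso; apply: NNPP => none; apply: niso; split.
    move=> /(root_nonnil im) ni; apply: none; exists i; split=> //.
    by rewrite in_setU xD orbT.
  move=> j jm /subsetP sF; apply: NNPP => nnil; apply: none; exists j; split=> //.
  by rewrite in_setU sF.
case=> j [nj xj] [nroot iso]; have [jm nnil] := nj.
have noF k : nonnil k -> i < k -> x \in Sup k -> False.
  move=> nk lt_ik xk; have [km nk2] := nk; apply: nk2; apply: iso => //.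
  apply/subsetP => c cD; have ck := nonnil_Sup_dif nk im xD cD xk.
  by have [eq_ik|[]] := Sup_index im km cD ck; first by rewrite eq_ik ltnn in lt_ik.
have [eq_ij|[lt_ij _]] := Sup_index im jm xD xj; last exact: (noF j).
rewrite -eq_ij in nj; have [k [nk lt_ik sub]] := nonnil_root nj nroot.
exact: (noF k nk lt_ik (subsetP sub _ xD)).
Qed.

Lemma Sup_edge j x : nonnil j -> x \in Sup j ->
  exists y, ~ sg_nilpotent mul (gen [set x; y]).
Proof.
move=> nj /(nonnil_SupP _ nj) hx; have [jm _] := nj; have jc := series_jclass jm.
have [cl [u [v [uD vD [nR|nL]]]]] := nonnil_factor nj.
  by have [y /wan_edge] := acting_partner_R mulA jc cl hx uD vD nR; exists y.
by have [y /wan_edge] := acting_partner_L mulA jc cl hx uD vD nL; exists y.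
Qed.

(** * Rees coordinates and the maps [Phi] *)

Section ReesCoordinates.
Variables (j : nat) (gT : finGroupType) (I L : finType) (P : L -> I -> gT).
Variable phi : T -> gT * I * L.
Hypothesis nj : nonnil j.
Hypothesis iso : rees_iso mul (D j) P phi.

Lemma Phi_Sup a : a \in Sup j -> exists2 p, Phi mul Ss j phi a = Some p &
  forall t, t \in D j -> (phi (a ** t)).1.2 = p.1 /\ (phi (t ** a)).2 = p.2.
Proof.
move=> aj; have ha : acts mul (D j) a by apply/(nonnil_SupP _ nj).
have [jm _] := nj; have jc := series_jclass jm; have [cl _] := nonnil_factor nj.
have [_ [_ phiM]] := iso; have [t0 t0D] := dif_ex jm.
rewrite /Phi aj; case: pickP => [p /andP[/forall_inP h1 /forall_inP h2]|none].
  exists p => // t tD; split; first by have /andP[_ /eqP] := h1 t tD.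
  by have /andP[_ /eqP] := h2 t tD.
(* The indices read off at one [t0] serve for every [t], since the products stay in one R-class and
   one L-class. *)
have := none ((phi (a ** t0)).1.2, (phi (t0 ** a)).2); rewrite /= => /negbT/negP[].
apply/andP; split; apply/forall_inP => t tD; have [atD taD] := ha t tD; have [at0 t0a] := ha t0 t0D.
  have [s sD ->] := Rrel_mul_in mulA jc cl at0 atD (acts_const_R mulA jc tm cl ha t0D tD).
  by have [-> ->] := phiM _ _ at0 sD; rewrite eqxx.
have [s sD ->] := Lrel_mul_in mulA jc cl t0a taD (acts_const_L mulA jc tm cl ha t0D tD).
by have [-> ->] := phiM _ _ sD t0a; rewrite eqxx.
Qed.

Lemma rees_divr x y : x \in D j -> y \in D j -> (phi x).1.2 = (phi y).1.2 ->
  exists2 s, s \in D j & y = x ** s.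
Proof.
move=> xD yD e; have [inj [sur phiM]] := iso.
(* The group entry of [s] solves [x ** s = y]; its row index merely selects the sandwich entry that
   is inverted. *)
have [s sD sE] := sur (((phi x).1.1 * P (phi x).2 (phi x).1.2)^-1 * (phi y).1.1, (phi x).1.2, (phi y).2)%g.
exists s => //; have [xsD xsE] := phiM _ _ xD sD.
apply: inj => //; rewrite xsE sE /rees_mul /= mulKVg e.
by case: (phi y) => [[]].
Qed.

Lemma rees_divl x y : x \in D j -> y \in D j -> (phi x).2 = (phi y).2 ->
  exists2 s, s \in D j & y = s ** x.
Proof.
move=> xD yD e; have [inj [sur phiM]] := iso.
have [s sD sE] := sur ((phi y).1.1 * (P (phi x).2 (phi x).1.2 * (phi x).1.1)^-1, (phi y).1.2, (phi x).2)%g.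
exists s => //; have [xsD xsE] := phiM _ _ sD xD.
apply: inj => //; rewrite xsE sE /rees_mul /= -mulgA mulgKV e.
by case: (phi y) => [[]].
Qed.

End ReesCoordinates.

End Series.

(** * Assembly of the six statements *)

Theorem theorem3p7 (T : finType) (mul : T -> T -> T) (Hassoc : associative mul)
  (m : nat) (Ss : nat -> {set T}) (K : {set T}) :
  pseudo_nilpotent mul ->
  principal_series mul m Ss ->
  (* K = union of all isolated subsets S_i \ S_{i+1} *)
  (forall x, x \in K <-> exists i, 1 <= i <= m /\ isolated mul m Ss i /\ x \in Dif Ss i) ->
  (* (1) *)
  ((is_ideal_in mul setT K /\ sg_nilpotent mul K /\
    (forall J : {set T}, is_ideal_in mul setT J -> sg_nilpotent mul J -> J \subset K)) /\
   (forall x, x \in K <-> forall y, ~ sg_edge mul x y)) /\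
  (* (2) *)
  (forall i1 i2 i3, 1 <= i1 <= m -> 1 <= i2 <= m -> 1 <= i3 <= m ->
     Dif Ss i1 \subset Sup mul Ss i2 -> Dif Ss i2 \subset Sup mul Ss i3 ->
     Dif Ss i1 \subset Sup mul Ss i3 /\
     (forall (gT2 : finGroupType) (I2 L2 : finType) (P2 : L2 -> I2 -> gT2)
             (phi2 : T -> gT2 * I2 * L2)
             (gT3 : finGroupType) (I3 L3 : finType) (P3 : L3 -> I3 -> gT3)
             (phi3 : T -> gT3 * I3 * L3),
        ~ nilpotent_mod mul (Ss i2) (Ss i2.+1) ->
        ~ nilpotent_mod mul (Ss i3) (Ss i3.+1) ->
        rees_iso mul (Dif Ss i2) P2 phi2 ->
        rees_iso mul (Dif Ss i3) P3 phi3 ->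
        forall a, a \in Dif Ss i1 ->
          exists (e : I2) (f : L2), Phi mul Ss i2 phi2 a = Some (e, f) /\
            forall (g : gT2) (h : T), h \in Dif Ss i2 -> phi2 h = (g, e, f) ->
              Phi mul Ss i3 phi3 a = Phi mul Ss i3 phi3 h)) /\
  (* (3) *)
  (forall i, 1 <= i <= m -> ~ isolated mul m Ss i -> ~ is_root mul Ss i ->
     exists j, i < j <= m /\ is_root mul Ss j /\ Dif Ss i \subset Sup mul Ss j) /\
  (* (4) *)
  (forall x, x \notin K <-> exists i, 1 <= i <= m /\ is_root mul Ss i /\ x \in Sup mul Ss i) /\
  (* (5) *)
  (forall i, 1 <= i <= m -> is_root mul Ss i -> sg_closed mul (Sup mul Ss i)) /\
  (* (6) *)
  (forall i j, 1 <= i <= m -> 1 <= j <= m ->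
     ((forall a b, a \in Dif Ss i -> b \in Dif Ss j -> mul a b \in K) <->
      ~ exists k, 1 <= k <= m /\ is_root mul Ss k /\
          Dif Ss i \subset Sup mul Ss k /\ Dif Ss j \subset Sup mul Ss k)).
Proof.
move=> pn ps KE.
have KP i x : 1 <= i <= m -> x \in Dif Ss i -> x \in K <-> isolated mul m Ss i.
  move=> im xD; split=> [/KE[j [jm [iso xj]]]|iso]; last by apply/KE; exists i.
  by rewrite (dif_inj ps im jm xD xj).
have notK x : x \notin K <-> exists j, nonnil mul m Ss j /\ x \in Sup mul Ss j.
  have [i im xD] := dif_index ps x.
  rewrite -(not_isolatedP Hassoc pn ps im xD) -(KP i x im xD).
  by split=> /negP.
have edgeK x y : ~ sg_nilpotent mul (sg_gen mul [set x; y]) -> x \notin K.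
  by move=> /(edge_Sup Hassoc pn ps)[j [nj xj _]]; apply/notK; exists j.
have K4 x : x \notin K <-> exists i, 1 <= i <= m /\ is_root mul Ss i /\ x \in Sup mul Ss i.
  rewrite notK; split=> [[j [nj xj]]|[i [im [root xi]]]].
    by have [k [km root xk]] := Sup_root Hassoc pn ps nj xj; exists k.
  by exists i; split=> //; apply: root_nonnil.
have idK : is_ideal_in mul setT K.
  split=> [|a x _ xK]; first exact: subsetT.
  split; apply: contraLR xK => /notK[j [nj]]; rewrite (nonnil_Sup_mul Hassoc pn ps _ _ nj) => /andP[h1 h2];
    by apply/notK; exists j.
split; [split; [split; [|split]|] |].
- exact: idK.
(* A wandering pair inside [K] would give a non-nilpotent two-generated subsemigroup, whose
   generators lie outside [K]. *)
- apply: NNPP => nnil.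
  have cK : sg_closed mul K.
    by apply/forall_inP => x _; apply/forall_inP => y yK; apply: (idK.2 _ _ (in_setT x) yK).1.
  have id0 : is_ideal_in mul K set0 by split; [apply: sub0set | move=> c u _; rewrite inE].
  have [x [y w]] := non_nilpotent_wan cK id0 nnil.
  have := edgeK x y (wan_edge pn (wan_sub (subsetT _) (subxx _) w)).
  by case: (wanP w) => _; rewrite in_setD => /andP[_ ->].
(* An ideal meeting [Sup j] contains an element of [D j], hence all of [D j] and with it a wandering
   pair, so it is not nilpotent. *)
- move=> J idJ nilJ; apply/subsetP => x xJ; apply/negPn/negP => /notK[j [nj xj]].
  have [jm nnil] := nj; have [t tD] := dif_ex ps jm.
  have [xtD _] := (nonnil_SupP Hassoc pn ps x nj).1 xj t tD.
  have xtJ : mul x t \in J := (idJ.2 t x (in_setT _) xJ).2.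
  have sDJ c : c \in Dif Ss j -> c \in J.
    move=> cD; have [p [q ->]] := jclass_conn (series_jclass Hassoc ps jm) xtD cD.
    have rJ : rm mul (mul x t) q \in J by case: q => //= q; apply: (idJ.2 q _ (in_setT _) xtJ).2.
    by case: p => //= p; apply: (idJ.2 p _ (in_setT _) rJ).1.
  have [lj rj] := andP jm.
  have idS := series_ideal ps (i := j); have idI := series_ideal ps (i := j.+1).
  have {}idS : is_ideal_in mul setT (Ss j) by apply: idS; rewrite lj leqW.
  have {}idI : is_ideal_in mul setT (Ss j.+1) by apply: idI.
  have clS (A : {set T}) : is_ideal_in mul setT A -> sg_closed mul A.
    by move=> id; apply/forall_inP => c _; apply/forall_inP => d dA; apply: (id.2 c d (in_setT _) dA).1.
  have idSI : is_ideal_in mul (Ss j) (Ss j.+1).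
    split; last by move=> c d _ dI; apply: idI.2.
    by rewrite -(dif_setU ps jm) subsetUl.
  have [u [v w]] := non_nilpotent_wan (clS _ idS) idSI nnil.
  have [_ uD vD _] := wanP w.
  case: (wan_edge pn (wan_sub (subsetT _) (subxx _) w)).
  rewrite /sg_nilpotent -(setI0 (sg_gen mul [set u; v])).
  apply: nilpotent_mod_sub nilJ (gen_closed _ _); apply: gen_min (clS _ idJ).
  by apply/subsetP => c; rewrite !inS => /orP[]/eqP->; apply: sDJ.
- move=> x; split=> [xK y|noedge].
    by rewrite /sg_edge /edge_mod setI0 => /edgeK; rewrite xK.
  apply/negPn/negP => /notK[j [nj xj]].
  have [y nxy] := Sup_edge Hassoc pn ps nj xj.
  by apply: (noedge y); rewrite /sg_edge /edge_mod setI0.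
split.
  move=> i1 i2 i3 im1 im2 im3 s12 s23.
  have s13 := Sup_trans Hassoc ps im1 im2 im3 s12 s23.
  split=> // gT2 I2 L2 P2 phi2 gT3 I3 L3 P3 phi3 nnil2 nnil3 iso2 iso3 a aD.
  have n2 : nonnil mul m Ss i2 by split.
  have n3 : nonnil mul m Ss i3 by split.
  have aS2 := subsetP s12 _ aD; have aS3 := subsetP s13 _ aD.
  have [[e f] Phi2 coord2] := Phi_Sup Hassoc pn ps n2 iso2 aS2.
  exists e, f; split=> // g h hD hE; have hS3 := subsetP s23 _ hD.
  have [p -> coorda] := Phi_Sup Hassoc pn ps n3 iso3 aS3.
  have [q -> coordh] := Phi_Sup Hassoc pn ps n3 iso3 hS3.
  have [ahD haD] := (nonnil_SupP Hassoc pn ps a n2).1 aS2 h hD.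
  have [ahE haE] := coord2 h hD.
  have [t tD] := dif_ex ps im3.
  have [cl2 _] := nonnil_factor Hassoc pn ps n2.
  have act3 u : u \in Dif Ss i2 -> acts mul (Dif Ss i3) u.
    by move=> uD; apply/(nonnil_SupP Hassoc pn ps _ n3); apply: (subsetP s23).
  (* Equal row indices give [h = a h s], so [h t = a (h s t)] and the first indices of [Phi] at [h]
     and [a] agree; dually [h = s' h a] settles the second. *)
  have [s sD hs] := rees_divr iso2 ahD hD (etrans ahE (esym (congr1 (fun u => u.1.2) hE))).
  have [s' sD' hs'] := rees_divl iso2 haD hD (etrans haE (esym (congr1 snd hE))).
  have hst := (act3 _ (cl2 _ _ hD sD) t tD).1.
  have tsh := (act3 _ (cl2 _ _ sD' hD) t tD).2.
  have [ht th] := coordh t tD.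
  have p1 : p.1 = q.1.
    by rewrite -ht -(coorda _ hst).1 {2}hs !Hassoc.
  have p2 : p.2 = q.2.
    by rewrite -th -(coorda _ tsh).2 {2}hs' !Hassoc.
  by rewrite (surjective_pairing p) (surjective_pairing q) p1 p2.
split.
  move=> i im niso nroot; have [x xD] := dif_ex ps im.
  have /K4 [j [jm [root xj]]] : x \notin K by apply/negP => /(KP i x im xD).
  have nj := root_nonnil jm root.
  exists j; split; last split=> //.
    case/andP: jm => j1 jm; rewrite jm andbT.
    have jm' : 1 <= j <= m by rewrite j1.
    (* The root index is at least [i], and equality is excluded because [i] is not a root. *)
    have [eq_ij|[]//] := Sup_index ps im jm' xD xj.
    by case: nroot; rewrite eq_ij.
  by apply/subsetP => c cD; apply: (nonnil_Sup_dif Hassoc pn ps nj im xD cD xj).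
split; first exact: K4.
split.
  move=> i im /(root_nonnil im) ni; apply/forall_inP => x xi; apply/forall_inP => y yi.
  by rewrite (nonnil_Sup_mul Hassoc pn ps _ _ ni) xi.
move=> i j im jm; split.
  move=> DK [k [km [root [si sj]]]]; have nk := root_nonnil km root.
  have [a aD] := dif_ex ps im; have [b bD] := dif_ex ps jm.
  suff /notK/negP : exists j, nonnil mul m Ss j /\ mul a b \in Sup mul Ss j by apply; apply: DK.
  by exists k; rewrite (nonnil_Sup_mul Hassoc pn ps _ _ nk) (subsetP si) ?(subsetP sj).
move=> none a b aD bD; apply/negPn/negP => /K4[k [km [root]]].
have nk := root_nonnil km root; rewrite (nonnil_Sup_mul Hassoc pn ps _ _ nk) => /andP[ak bk].
apply: none; exists k; split=> //; split=> //.
by split; apply/subsetP => c cD; [apply: (nonnil_Sup_dif Hassoc pn ps nk im aD cD ak)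
  | apply: (nonnil_Sup_dif Hassoc pn ps nk jm bD cD bk)].
Qed.
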